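(* Let $f:\mathbb{R}^n\to\mathbb{R}$ be convex and differentiable with $L$-Lipschitz continuous gradient, and let $x_*$ be a minimiser, $f(x_* )=\min_{x\in\mathbb{R}^n}f(x)$, with $\|x_*\|\le R$. Let $\delta\in(0,1)$. Then the output $x_T$ of the Primal method (defined in the context) with iterations number $T$ and parameters $\boldsymbol{\alpha},\boldsymbol{\beta},\boldsymbol{r},\boldsymbol{M}$ satisfies $$P\big(f(x_T)-f(x_* )\le \varepsilon(T,\delta,\boldsymbol{\alpha},\boldsymbol{\beta},\boldsymbol{r},\boldsymbol{M})\big)>1-\delta,$$ where $$\varepsilon(T,\delta,\boldsymbol{\alpha},\boldsymbol{\beta},\boldsymbol{r},\boldsymbol{M})=\frac{\beta_TR^2}{2A_T}+\frac{C_1'R}{A_T}\sqrt{\sum_{t=0}^T\alpha_t^2\sigma_{r_t,M_t}^2}+\frac{C_2'}{A_T}\sum_{t=0}^T\frac{A_t\sigma_{r_t,M_t}^2}{\beta_t-L},$$ $C_2'=1+\ln\frac4\delta=O(\log 1/\delta)$ and $$C_1'=\left(2J(T)+\sqrt2-1\right)\left(\sqrt2+(\sqrt2+1)\sqrt{3\ln\tfrac4\delta}\right)+\sqrt2-2=O(poly(\log T)\sqrt{\log 1/\delta}).$$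
   Context: Notation: $\|\cdot\|$ Euclidean norm, $\|\cdot\|_1$ the $\ell_1$ norm, $\boldsymbol{e}_i$ standard basis vectors, $[\boldsymbol{v}]_+$ the componentwise positive part. $poly(h)$ denotes $1+h+\dots+h^i$ for some fixed $i\in\mathbb{N}$. Oracle: a stochastic gradient oracle $g(x,\xi)$ is available with, for all $x$: $\mathbb{E}_\xi[g(x,\xi)]=\nabla f(x)$; $\mathbb{E}_\xi[\exp(\|g(x,\xi)-\nabla f(x)\|^2/\sigma^2)]\le\mathrm{e}$; $\|g(x,\xi)\|_1\le B$ for all $\xi\in\Xi$. PPS quantized gradient oracle with batch size $r$ and $M$ samples: for $\boldsymbol{\xi}\in\Xi^r$ with independent components, $\boldsymbol{G}=\frac1r\sum_{i=1}^rg(x,\xi_i)$; $\boldsymbol{k},\boldsymbol{l}\in\{1,\dots,n\}^M$ are i.i.d. samples from the categorical distributions with probabilities $[G_k]_+/\|[\boldsymbol{G}]_+\|_1$ and $[-G_k]_+/\|[-\boldsymbol{G}]_+\|_1$, respectively; and $$PPS(x,\boldsymbol{\xi},\boldsymbol{k},\boldsymbol{l})=\frac{\|[\boldsymbol{G}]_+\|_1}{M}\sum_{i=1}^M\boldsymbol{e}_{k_i}-\frac{\|[-\boldsymbol{G}]_+\|_1}{M}\sum_{i=1}^M\boldsymbol{e}_{l_i}$$ (terms with zero prefactor are zero). Put $\sigma_{r,M}^2=50\left(\frac{2(1-1/n)B^2}{\mathrm{e}M}+\frac{\sigma^2}{r}\right)$. Coefficients satisfy: $\alpha_0\in(0,1]$;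 $L<\beta_t\le\beta_{t+1}$; $\alpha_t^2\beta_t\le\beta_{t-1}\sum_{i=0}^t\alpha_i$ (for all $t$ for which the indices make sense). $A_t=\sum_{i=0}^t\alpha_i$. $\boldsymbol{r}=(r_t)$, $\boldsymbol{M}=(M_t)$ are the batch sizes and quantization sample numbers at the iterations. Primal method: $y_0=0$; $G_0=PPS(y_0,\boldsymbol{\xi}_0,\boldsymbol{k}_0,\boldsymbol{l}_0)$; $x_0=-\frac{\alpha_0}{\beta_0}G_0$. For $t=0,\dots,T-1$: $z_t=-\frac1{\beta_t}\sum_{i=0}^t\alpha_iG_i$; $\tau_t=\alpha_{t+1}/A_{t+1}$; $y_{t+1}=\tau_tz_t+(1-\tau_t)x_t$; $G_{t+1}=PPS(y_{t+1},\boldsymbol{\xi}_{t+1},\boldsymbol{k}_{t+1},\boldsymbol{l}_{t+1})$; $\hat y_{t+1}=z_t-\frac{\alpha_{t+1}}{\beta_t}G_{t+1}$; $x_{t+1}=\tau_t\hat y_{t+1}+(1-\tau_t)x_t$. The randomness at iteration $t$ is fresh, with batch size $r_t$ and $M_t$ quantization samples. The output is $x_T$. Standing convention on $J(T)$: $R_*$ is a bound with $\|y_t-x_*\|\le R_*$ for all $t=0,\dots,T$, and $J(T)$ is the factor with $R_*=J(T)R$; it is taken that $J(T)=O(poly(\log T))$.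
   Formalization: The coefficients are additionally assumed nonnegative, α_t ≥ 0 for all t ≤ T; with negative coefficients satisfying the listed inequalities the bound can fail (n=1, exact oracle, locally quadratic f). *)

(* Defs.v *)
From HB Require Import structures.
From mathcomp Require Export all_boot all_order all_algebra.
From mathcomp Require Export all_classical all_reals all_analysis.
Export Order.TTheory GRing.Theory Num.Theory.
Export numFieldNormedType.Exports.

Set Implicit Arguments.
Unset Strict Implicit.
Unset Printing Implicit Defensive.

Local Open Scope classical_set_scope.
Local Open Scope ring_scope.

Section Vectors.
Context {R : realType} {n : nat}.
Implicit Types v : 'rV[R]_n.

(* The library's norm on ['rV[R]_n] is the sup norm, hence the explicit
   Euclidean and l1 norms.  The sup norm is only used (through
   [differentiable]) for the topology. *)
Definition norm2 v : R := Num.sqrt (\sum_(i < n) v 0 i ^+ 2).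

Definition norm1 v : R := \sum_(i < n) `|v 0 i|.

Definition pos_part v : 'rV[R]_n := \row_(i < n) Num.max (v 0 i) 0.

Definition gradient (f : 'rV[R]_n -> R) (x : 'rV[R]_n) : 'rV[R]_n :=
  \row_(i < n) 'D_(delta_mx 0 i) f x.

End Vectors.

Section Oracle.
Context {R : realType} {n : nat} {d : measure_display} {Xi : measurableType d}.
Variables (mu : probability Xi R) (g : 'rV[R]_n -> Xi -> 'rV[R]_n).

(* Joint measurability is what makes [g (y w) (xi w)] a random vector at a
   random query point [y].  R^n carries the product sigma-algebra, which the
   library provides on [n.-tuple R]. *)
Record stochastic_oracle (f : 'rV[R]_n -> R) (sigma B : R) : Prop := {
  oracle_measurable : forall i : 'I_n,
    measurable_fun [set: n.-tuple R * Xi]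
      (fun p => g (\row_(j < n) tnth p.1 j) p.2 0 i) ;
  oracle_unbiased : forall (x : 'rV[R]_n) (i : 'I_n),
    ('E_mu[fun u => g x u 0%R i] = (gradient f x 0%R i)%:E)%E ;
  oracle_light_tail : forall x : 'rV[R]_n,
    ('E_mu[fun u => expR (norm2 (g x u - gradient f x) ^+ 2 / sigma ^+ 2)%R]
      <= (expR 1)%:E)%E ;
  oracle_bounded : forall (x : 'rV[R]_n) (u : Xi), norm1 (g x u) <= B
}.

Definition minibatch (r : nat) (x : 'rV[R]_n) (xi : nat -> Xi) : 'rV[R]_n :=
  r%:R^-1 *: \sum_(i < r) g x (xi i).

Definition PPS (r M : nat) (x : 'rV[R]_n) (xi : nat -> Xi)
    (k l : nat -> 'I_n) : 'rV[R]_n :=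
  let G := minibatch r x xi in
  (norm1 (pos_part G) / M%:R) *: \sum_(i < M) delta_mx 0 (k i)
  - (norm1 (pos_part (- G)) / M%:R) *: \sum_(i < M) delta_mx 0 (l i).

End Oracle.

(* When [[v]_+] vanishes the categorical distribution is undefined, but the
   sampled index is then multiplied by 0; the uniform law is a harmless
   convention keeping [categorical v] a probability mass function. *)
Definition categorical {R : realType} {n : nat} (v : 'rV[R]_n) (i : 'I_n) : R :=
  if norm1 (pos_part v) == 0 then n%:R^-1
  else pos_part v 0 i / norm1 (pos_part v).

Section Sampling.
Context {R : realType} {n : nat}.
Context {d : measure_display} {Omega : measurableType d}.
Context {dX : measure_display} {Xi : measurableType dX}.
Variables (P : probability Omega R) (mu : probability Xi R).
Variable g : 'rV[R]_n -> Xi -> 'rV[R]_n.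
Variables (T : nat) (r M : nat -> nat).
(* [xi t i] for [i < r t], and [k t j], [l t j] for [j < M t], are the samples
   drawn at iteration [t]; [y t] is the query point of iteration [t]. *)
Variables (xi : nat -> nat -> Omega -> Xi) (k l : nat -> nat -> Omega -> 'I_n).
Variable y : nat -> Omega -> 'rV[R]_n.

(* sigma-algebra of the batches of iterations [< tb] and of the quantization
   samples of iterations [< tq] *)
Definition history (tb tq : nat) : set (set Omega) :=
  <<s [set E | (exists s i (C : set Xi), [/\ (s < tb)%N, (i < r s)%N,
                  measurable C & E = xi s i @^-1` C]) \/
               (exists s j (a : 'I_n), [/\ (s < tq)%N, (j < M s)%N &
                  E = k s j @^-1` [set a] \/ E = l s j @^-1` [set a]])] >>.

(* Fresh randomness for iterations [0..T]: given the past, the batch is i.i.d.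
   with law [mu]; given in addition the batch, the [2 * M t] quantization
   samples are independent with the two categorical laws of the batch
   gradient (the conditional laws are written as identities tested on all
   events of the conditioning sigma-algebra). *)
Record fresh_sampling : Prop := {
  batch_measurable : forall t i, (t <= T)%N -> (i < r t)%N ->
    measurable_fun setT (xi t i) ;
  quant_measurable : forall t j, (t <= T)%N -> (j < M t)%N -> forall a : 'I_n,
    measurable (k t j @^-1` [set a]) /\ measurable (l t j @^-1` [set a]) ;
  batch_law : forall t, (t <= T)%N ->
    forall (H : set Omega) (C : nat -> set Xi), history t t H ->
    (forall i, measurable (C i)) ->
    (P (H `&` [set w | forall i, (i < r t)%N -> C i (xi t i w)])
     = P H * \prod_(i < r t) mu (C i))%E ;
  quant_law : forall t, (t <= T)%N ->
    forall (H : set Omega) (a b : nat -> 'I_n), history t.+1 t H ->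
    (P (H `&` [set w | forall j, (j < M t)%N -> k t j w = a j /\ l t j w = b j])
     = \int[P]_(w in H)
         (let G := minibatch g (r t) (y t w) (fun i => xi t i w) in
          (\prod_(j < M t) categorical G (a j)) *
          (\prod_(j < M t) categorical (- G) (b j)))%R%:E)%E
}.

End Sampling.

Section Method.
Context {R : realType} {n : nat}.
Variables (T : nat) (alpha beta : nat -> R).

Definition Asum (t : nat) : R := \sum_(i < t.+1) alpha i.

(* Nonnegativity is part of the meaning of "coefficients": they are the weights
   of the averages [y t.+1] and [x t.+1], and the other conditions alone do not
   exclude negative weights. *)
Record coefficients (L : R) : Prop := {
  alpha0_gt0 : 0 < alpha 0%N ;
  alpha0_le1 : alpha 0%N <= 1 ;
  alpha_ge0 : forall t, (t <= T)%N -> 0 <= alpha t ;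
  beta_gtL : forall t, (t <= T)%N -> L < beta t ;
  beta_nondecreasing : forall t, (t < T)%N -> beta t <= beta t.+1 ;
  alpha_beta : forall t, (t < T)%N ->
    alpha t.+1 ^+ 2 * beta t.+1 <= beta t * Asum t.+1
}.

Definition tau (t : nat) : R := alpha t.+1 / Asum t.+1.

(* One realization of the method; [oracle t v] is the answer at iteration [t]
   to the query [v]. *)
Record primal_method (oracle : nat -> 'rV[R]_n -> 'rV[R]_n)
    (x y z yhat G : nat -> 'rV[R]_n) : Prop := {
  primal_y0 : y 0%N = 0 ;
  primal_G : forall t, (t <= T)%N -> G t = oracle t (y t) ;
  primal_x0 : x 0%N = - (alpha 0%N / beta 0%N) *: G 0%N ;
  primal_z : forall t, (t < T)%N ->
    z t = - (beta t)^-1 *: \sum_(i < t.+1) alpha i *: G i ;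
  primal_y : forall t, (t < T)%N ->
    y t.+1 = tau t *: z t + (1 - tau t) *: x t ;
  primal_yhat : forall t, (t < T)%N ->
    yhat t.+1 = z t - (alpha t.+1 / beta t) *: G t.+1 ;
  primal_x : forall t, (t < T)%N ->
    x t.+1 = tau t *: yhat t.+1 + (1 - tau t) *: x t
}.

End Method.

Section Rates.
Context {R : realType}.

Definition sigma2 (n : nat) (B sigma : R) (r M : nat) : R :=
  50 * (2 * (1 - n%:R^-1) * B ^+ 2 / (expR 1 * M%:R) + sigma ^+ 2 / r%:R).

Definition C1 (J delta : R) : R :=
  (2 * J + Num.sqrt 2 - 1) *
  (Num.sqrt 2 + (Num.sqrt 2 + 1) * Num.sqrt (3 * ln (4 / delta)))
  + Num.sqrt 2 - 2.

Definition C2 (delta : R) : R := 1 + ln (4 / delta).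

Definition epsilon (n T : nat) (J Rad L B sigma delta : R)
    (alpha beta : nat -> R) (r M : nat -> nat) : R :=
  beta T * Rad ^+ 2 / (2 * Asum alpha T)
  + C1 J delta * Rad / Asum alpha T
    * Num.sqrt (\sum_(t < T.+1) alpha t ^+ 2 * sigma2 n B sigma (r t) (M t))
  + C2 delta / Asum alpha T
    * \sum_(t < T.+1)
        (Asum alpha t * sigma2 n B sigma (r t) (M t) / (beta t - L)).

Definition poly_upto (i : nat) (h : R) : R := \sum_(j < i.+1) h ^+ j.

End Rates.

(* Main.v *)
Require Import Defs.
From HB Require Import structures.
From mathcomp Require Import measurable_realfun.
From mathcomp Require Import ring lra zify.

(** Why the theorem holds.

    Let [e_t] be the error of the quantized oracle at iteration [t], let [c_t]
    be the dual centre before iteration [t] ([dual_center]: the origin first,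
    then [z_(t-1)]), and collect in
      [N_t = sum_(i < t) (alpha_i <e_i, xs - c_i> + A_i |e_i|^2 / (2 (beta_i - L)))]
    ([noise]) all that the errors contribute to the convergence analysis. The
    estimating-sequence argument is deterministic and gives
    ([primal_potential])
      [A_t (f x_t - f xs) + beta_t / 2 |xs - c_(t+1)|^2
         <= beta_t / 2 |xs|^2 + N_(t+1)].
    This inequality is used twice. At [t = T] it reduces the theorem to a bound
    on the upper tail of [N_(T+1)]. At earlier times it bounds the distance from
    [xs] to the dual centre, which governs the variance of the next increment of
    the noise, by the noise itself.

    The tail bound is an exponential-moment argument. Conditionally on the past,
    [E exp(<u, e_t> + kappa |e_t|^2)] is at most
    [exp(v_t / 5 |u|^2 + kappa v_t / 2)] when [kappa v_t <= 5 / 6], where [v_t]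
    is the variance proxy [sigma2] of iteration [t] ([oracle_call_mgf]). The
    error is the sum of a quantization error and a minibatch error, both sums of
    i.i.d. centred vectors; for one vector the elementary inequality
    [exp(x + y) <= x + exp(x^2 + 2 y)] does the job, and for a sum one summand
    at a time is averaged out, each time reproducing the exponential of a
    quadratic form ([mgf_budget_step]). No dimension appears, and the factor 50
    in [sigma2] pays for the numerical constants.

    Applied to the increments of the noise with [u] proportional to
    [xs - c_t], this yields a recursion: averaging out iteration [t] multiplies
    the rate [lam] in [E exp(lam N)] by a factor close to one, because
    [|xs - c_t|^2] is at most an affine function of [N_t]. The condition
    [alpha_t^2 beta_t <= beta_(t-1) A_t] makes the product of these factors
    bounded as long as [lam] times [sum_t A_t v_t / (beta_t - L)] is at most one
    ([noise_mgf]). Chernoff's bound with the rate balancing the two terms of the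
    exponent gives a failure probability of at most [delta / 4]
    ([noise_tail]).

    Two measure-theoretic facts connect this to the sampling scheme: a sample
    independent of the past may be averaged out with the past frozen
    ([integral_freeze]), and the conditional law of the quantization indices,
    given on events of the past, also weights functions of the past
    ([integral_density]). Since [f] is a limit of Riemann sums of its gradient,
    and the gradient is an average of the oracle, all the quantities involved
    are measurable. *)

Set Implicit Arguments.
Unset Strict Implicit.
Unset Printing Implicit Defensive.

Local Open Scope classical_set_scope.
Local Open Scope ring_scope.

(** * Inner product and smooth convex functions *)

Section InnerProduct.
Context {R : realType} {n : nat}.
Implicit Types u v w : 'rV[R]_n.

Definition dot u v : R := \sum_(i < n) u 0 i * v 0 i.

Lemma dotC u v : dot u v = dot v u.
Proof. by apply: eq_bigr => i _; rewrite mulrC. Qed.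

Lemma dotDl u v w : dot (u + v) w = dot u w + dot v w.
Proof. by rewrite -big_split; apply: eq_bigr => i _; rewrite !mxE mulrDl. Qed.

Lemma dotZl a u v : dot (a *: u) v = a * dot u v.
Proof. by rewrite mulr_sumr; apply: eq_bigr => i _; rewrite mxE mulrA. Qed.

Lemma dotDr u v w : dot u (v + w) = dot u v + dot u w.
Proof. by rewrite dotC dotDl !(dotC u). Qed.

Lemma dotZr a u v : dot u (a *: v) = a * dot u v.
Proof. by rewrite dotC dotZl dotC. Qed.

Lemma dotNl u v : dot (- u) v = - dot u v.
Proof. by rewrite -scaleN1r dotZl mulN1r. Qed.

Lemma dotNr u v : dot u (- v) = - dot u v.
Proof. by rewrite dotC dotNl dotC. Qed.

Lemma dot0l v : dot 0 v = 0.
Proof. by rewrite -(scale0r 0) dotZl mul0r. Qed.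

Lemma dot0r v : dot v 0 = 0.
Proof. by rewrite dotC dot0l. Qed.

Definition dotE := (dotDl, dotDr, dotNl, dotNr, dotZl, dotZr, dot0l, dot0r).

Lemma dot_ge0 v : 0 <= dot v v.
Proof. by apply: sumr_ge0 => i _; rewrite -expr2 sqr_ge0. Qed.

Lemma norm2_ge0 v : 0 <= norm2 v.
Proof. exact: sqrtr_ge0. Qed.

Lemma sqr_norm2 v : norm2 v ^+ 2 = dot v v.
Proof.
rewrite sqr_sqrtr; last by apply: sumr_ge0 => i _; rewrite sqr_ge0.
by apply: eq_bigr => i _; rewrite expr2.
Qed.

Lemma dot_eq0 u v : dot v v = 0 -> dot u v = 0.
Proof.
move=> /eqP; rewrite psumr_eq0; last by move=> i _; rewrite -expr2 sqr_ge0.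
move=> /allP h; apply: big1 => i _.
by have /eqP := h i (mem_index_enum _); rewrite -expr2 => /eqP; rewrite sqrf_eq0 => /eqP->; rewrite mulr0.
Qed.

Lemma sqr_dot_le u v : dot u v ^+ 2 <= dot u u * dot v v.
Proof.
have [v0|v0] := eqVneq (dot v v) 0; first by rewrite dot_eq0 // expr0n /= v0 mulr0.
have vp : 0 < dot v v by rewrite lt_neqAle eq_sym v0 dot_ge0.
have := dot_ge0 (dot v v *: u - dot u v *: v).
rewrite !dotE (dotC v u) => h.
rewrite -subr_ge0 -(pmulr_rge0 _ vp); apply: le_trans h _.
by rewrite le_eqVlt; apply/orP; left; apply/eqP; ring.
Qed.

Lemma normr_dot_le u v : `|dot u v| <= norm2 u * norm2 v.
Proof.
rewrite -(@ler_pXn2r _ 2) ?nnegrE ?mulr_ge0 ?norm2_ge0 ?normr_ge0 //.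
by rewrite exprMn !sqr_norm2 real_normK ?num_real // sqr_dot_le.
Qed.

End InnerProduct.

Section Smooth.
Context {R : realType} {n : nat} (f : 'rV[R]_n -> R).
Hypothesis fdiff : forall x : 'rV[R]_n, differentiable f x.

Lemma diff_gradient x h : 'd f x h = dot (gradient f x) h.
Proof.
rewrite {1}(row_sum_delta h) linear_sum; apply: eq_bigr => i _.
by rewrite linearZ /= mxE deriveE // mulrC.
Qed.

Lemma is_derive_line x h (s : R) :
  is_derive s 1 (fun s => f (x + s *: h)) (dot (gradient f (x + s *: h)) h).
Proof.
have hl : is_diff s (fun s : R => x + s *: h) ( *:%R^~ h).
  have hD := @is_diffD _ _ _ _ _ _ _ s (is_diff_cst x s) (is_diff_scalel s h).
  by rewrite add0r in hD.
have hf : is_diff (x + s *: h) f ('d f (x + s *: h)) by exact: DiffDef.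
have hc : is_diff s (f \o (fun s : R => x + s *: h)) ('d f (x + s *: h) \o *:%R^~ h).
  exact: is_diff_comp.
apply: DeriveDef; first exact/derivable1_diffP/ex_diff.
rewrite deriveE; last exact/ex_diff.
by rewrite diff_val /= scale1r diff_gradient.
Qed.

Variable L : R.
Hypothesis fLip : forall x y : 'rV[R]_n,
  norm2 (gradient f x - gradient f y) <= L * norm2 (x - y).

Lemma gradient_along_line x h (s : R) : 0 <= s ->
  `|dot (gradient f (x + s *: h)) h - dot (gradient f x) h| <= s * (L * dot h h).
Proof.
move=> s0; rewrite -dotNl -dotDl; apply: le_trans (normr_dot_le _ _) _.
have := fLip (x + s *: h) x; rewrite [x + _]addrC addrK [s *: h + x]addrC.
have -> : norm2 (s *: h) = s * norm2 h.
  apply/eqP; rewrite -(@eqrXn2 _ 2) ?mulr_ge0 ?norm2_ge0 //.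
  by rewrite exprMn !sqr_norm2 !dotE expr2 mulrA.
move=> /(ler_wpM2r (norm2_ge0 h)) /le_trans; apply.
by rewrite -sqr_norm2 le_eqVlt; apply/orP; left; apply/eqP; ring.
Qed.

(** Along a segment the derivative of [f] exceeds its initial value by at most
    [L] times the distance travelled; integrating gives the quadratic bound. *)
Lemma smooth_upper x h :
  f (x + h) <= f x + dot (gradient f x) h + L / 2 * dot h h.
Proof.
pose phi (s : R) := f (x + s *: h) - s * dot (gradient f x) h - s ^+ 2 * (L / 2 * dot h h).
have dphi (s : R) : is_derive s 1 phi
   (dot (gradient f (x + s *: h)) h - dot (gradient f x) h - 2 * s * (L / 2 * dot h h)).
  apply: is_derive_eq.
    apply: is_deriveB; first apply: is_deriveB; first exact: is_derive_line.
  rewrite ?scaler0 ?add0r /GRing.scale /= ; ring.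
have cphi : {within `[0, 1], continuous phi}.
  apply: continuous_subspaceT => s.
  by apply/differentiable_continuous/derivable1_diffP; have [] := dphi s.
have [s /andP[s0 s1] e] := MVT ltr01 (fun s _ => dphi s) cphi.
rewrite bnd_simp in s0.
have {e} : phi 1 - phi 0 <= 0.
  rewrite e subr0 mulr1.
  have := le_trans (ler_norm _) (gradient_along_line x h (ltW s0)).
  have -> : 2 * s * (L / 2 * dot h h) = s * (L * dot h h) by field.
  by rewrite subr_le0.
rewrite /phi scale1r scale0r addr0 mul0r mul1r !expr2 !mul1r !mul0r; lra.
Qed.

End Smooth.

Section Convex.
Context {R : realType} {n : nat} (f : 'rV[R]_n -> R).
Hypothesis fdiff : forall x : 'rV[R]_n, differentiable f x.
Hypothesis fconv : @convex_function R 'rV[R]_n setT f.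
Variable L : R.
Hypothesis fLip : forall x y : 'rV[R]_n,
  norm2 (gradient f x - gradient f y) <= L * norm2 (x - y).

Lemma convex_segment x h (s : R) : 0 <= s -> s <= 1 ->
  f (x + s *: h) <= f x + s * (f (x + h) - f x).
Proof.
move=> s0 s1.
have := fconv (Itv01 s0 s1) (mem_setT (x + h)) (mem_setT x).
rewrite convRE /= /unstable.onem.
have -> : conv (Itv01 s0 s1) (x + h : convex_lmodType _) (x : convex_lmodType _) = x + s *: h.
  rewrite /conv /= /unstable.onem /=.
  by rewrite scalerDr scalerBl scale1r [s *: x + _]addrC -addrA [s *: x + _]addrC subrK addrC.
by lra.
Qed.

(** The difference quotients of [f] along [h] are at most [f (x + h) - f x]
    by convexity, and they tend to the derivative at a linear rate by the
    Lipschitz bound; a step [s] small compared with the alleged gap gives the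
    contradiction. *)
Lemma convex_lower x h : f x + dot (gradient f x) h <= f (x + h).
Proof.
rewrite leNgt; apply/negP => lt.
set c := dot (gradient f x) h in lt.
set K := L * dot h h.
have slope (s : R) : 0 <= s -> s <= 1 -> s * (c - (f (x + h) - f x)) <= s * (3 / 2 * s * K).
  move=> s0 s1.
  have := convex_segment x h s0 s1.
  have := smooth_upper fdiff fLip (x + s *: h) (- s *: h).
  have := gradient_along_line fLip x h s0.
  rewrite ler_norml => /andP[+ _].
  rewrite -addrA -scalerDl subrr scale0r addr0 !dotE -/c -/K => le1.
  have := ler_wpM2l s0 le1.
  have -> : L / 2 * (- s * (- s * dot h h)) = 1 / 2 * s ^+ 2 * K by rewrite /K; field.
  nra.
have K0 : 0 <= K.
  have := le_trans (norm2_ge0 _) (fLip h 0).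
  rewrite subr0 => /mulr_ge0 /(_ (norm2_ge0 h)).
  by rewrite -mulrA -expr2 sqr_norm2.
set gap := c - (f (x + h) - f x) in slope.
have gap0 : 0 < gap by rewrite /gap; lra.
have den0 : 0 < gap + 3 / 2 * K + 1 by lra.
have s0 : 0 < gap / (gap + 3 / 2 * K + 1) by rewrite divr_gt0.
have s1 : gap / (gap + 3 / 2 * K + 1) <= 1 by rewrite ler_pdivrMr //; lra.
have := slope _ (ltW s0) s1; rewrite ler_pM2l // => le1.
have : gap * (gap + 3 / 2 * K + 1) <= 3 / 2 * gap * K.
  rewrite -ler_pdivlMr //; apply: le_trans le1 _.
  by rewrite le_eqVlt; apply/orP; left; apply/eqP; field; apply: lt0r_neq0; lra.
nra.
Qed.

End Convex.

(** * The estimating-sequence inequality *)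

Section PrimalPotential.
Context {R : realType} {n : nat} (f : 'rV[R]_n -> R).
Hypothesis fdiff : forall x : 'rV[R]_n, differentiable f x.
Hypothesis fconv : @convex_function R 'rV[R]_n setT f.
Variable L : R.
Hypothesis fLip : forall x y : 'rV[R]_n,
  norm2 (gradient f x - gradient f y) <= L * norm2 (x - y).

(** Descent of a gradient step taken with an inexact gradient [G]; the gap
    between [b] and [L] is what absorbs the error. *)
Lemma inexact_gradient_step (y G : 'rV[R]_n) (s b : R) :
  L < b -> 0 <= s -> b * s <= 1 ->
  f (y - s *: G) <= f y - s / 2 * dot G G
     + dot (G - gradient f y) (G - gradient f y) / (2 * (b - L)).
Proof.
move=> Lb s0 bs.
set e := G - gradient f y.
have -> : - (s *: G) = - s *: G by rewrite scaleNr.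
apply: le_trans (smooth_upper fdiff fLip _ _) _.
have -> : gradient f y = G - e by rewrite /e opprB addrC subrK.
clearbody e.
have bL : 0 < b - L by lra.
(* Young's inequality for the inner product of the error and the step *)
have := dot_ge0 (e - (b - L) * s *: G).
rewrite !dotE (dotC e G).
set ee := dot e e; set eG := dot G e; set GG := dot G G => h.
have GG0 : 0 <= GG by exact: dot_ge0.
have {}h : s * eG <= ee / (2 * (b - L)) + (b - L) / 2 * s ^+ 2 * GG.
  rewrite -(ler_pM2l bL) mulrDr.
  have -> : (b - L) * (ee / (2 * (b - L))) = ee / 2 by field; apply: lt0r_neq0.
  by nra.
have := mulr_ge0 s0 GG0 => sGG.
by nra.
Qed.

Variables (T : nat) (alpha beta : nat -> R).
Hypothesis coef : coefficients T alpha beta L.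
Hypothesis L0 : 0 <= L.

Lemma beta_gt0 t : (t <= T)%N -> 0 < beta t.
Proof. by move=> tT; apply: le_lt_trans L0 (beta_gtL coef tT). Qed.

Lemma AsumS t : Asum alpha t.+1 = Asum alpha t + alpha t.+1.
Proof. by rewrite /Asum big_ord_recr. Qed.

Lemma Asum_gt0 t : (t <= T)%N -> 0 < Asum alpha t.
Proof.
elim: t => [|t IH] tT; first by rewrite /Asum big_ord1 (alpha0_gt0 coef).
by rewrite AsumS ltr_wpDr ?(alpha_ge0 coef) // IH // ltnW.
Qed.

(** The minimiser of the dual model before iteration [t]; it is the origin
    when [t = 0]. *)
Definition dual_center (G : nat -> 'rV[R]_n) (t : nat) : 'rV[R]_n :=
  - (beta t.-1)^-1 *: \sum_(i < t) alpha i *: G i.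

Definition gradient_error (y G : nat -> 'rV[R]_n) (t : nat) : 'rV[R]_n :=
  G t - gradient f (y t).

(** Everything the gradient errors of the first [t] iterations can contribute
    to the potential: a martingale part and a second-order part. *)
Definition noise (xs : 'rV[R]_n) (y G : nat -> 'rV[R]_n) (t : nat) : R :=
  \sum_(i < t) (alpha i * dot (gradient_error y G i) (xs - dual_center G i)
    + Asum alpha i * dot (gradient_error y G i) (gradient_error y G i)
      / (2 * (beta i - L))).

Variable oracle : nat -> 'rV[R]_n -> 'rV[R]_n.
Variables x y z yhat G : nat -> 'rV[R]_n.
Hypothesis method : primal_method T alpha beta oracle x y z yhat G.

Lemma dual_center0 : dual_center G 0 = 0.
Proof. by rewrite /dual_center big_ord0 scaler0. Qed.

Lemma dual_centerS t : (t < T)%N -> dual_center G t.+1 = z t.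
Proof. by move=> tT; rewrite (primal_z method tT). Qed.

Lemma scale_dual_centerS t : (t <= T)%N ->
  beta t *: dual_center G t.+1 = - \sum_(i < t.+1) alpha i *: G i.
Proof.
move=> tT; rewrite /dual_center scalerA mulrN divff ?scaleN1r //.
exact: lt0r_neq0 (beta_gt0 tT).
Qed.

(** Minimum over [v] of the dual model
    [sum_i alpha_i (f y_i + <G_i, v - y_i>) + beta_t / 2 |v|^2]. *)
Let model_min t := \sum_(i < t.+1) alpha i * (f (y i) - dot (G i) (y i))
  - beta t / 2 * dot (dual_center G t.+1) (dual_center G t.+1).

(** What the errors cost in the invariant [A_t f (x_t) <= model_min t]. *)
Let model_error t := \sum_(i < t.+1)
  (alpha i * dot (gradient_error y G i) (y i - dual_center G i)
    + Asum alpha i * dot (gradient_error y G i) (gradient_error y G i)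
      / (2 * (beta i - L))).

Let model_invariant t : (t <= T)%N ->
  Asum alpha t * f (x t) <= model_min t + model_error t.
Proof.
elim: t => [|t IH] tT.
  have b0 := beta_gt0 (leq0n T).
  have a0 := alpha0_gt0 coef.
  rewrite /model_min /model_error !big_ord1 /= dual_center0 (primal_y0 method).
  have : gradient_error y G 0 = G 0%N - gradient f 0.
    by rewrite /gradient_error (primal_y0 method).
  move: (gradient_error y G 0) => e eE.
  rewrite subrr !dotE /Asum big_ord1 /=.
  rewrite /dual_center big_ord1 /= !dotE (primal_x0 method).
  have s0 : 0 <= alpha 0%N / beta 0%N by rewrite divr_ge0 ?ltW.
  have bs : beta 0%N * (alpha 0%N / beta 0%N) <= 1.
    by rewrite mulrCA divff ?mulr1 ?(alpha0_le1 coef) // lt0r_neq0.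
  have := inexact_gradient_step 0 (G 0%N) (beta_gtL coef (leq0n T)) s0 bs.
  rewrite add0r scaleNr -eE => /(ler_wpM2l (ltW a0)) /le_trans; apply.
  rewrite le_eqVlt; apply/orP; left; apply/eqP.
  have bL : 0 < beta 0%N - L by rewrite subr_gt0 (beta_gtL coef).
  by field; rewrite (lt0r_neq0 b0) (lt0r_neq0 bL).
have {}IH := IH (ltnW tT).
have A0 := Asum_gt0 (ltnW tT).
have A1 := Asum_gt0 tT.
have b0 := beta_gt0 (ltnW tT).
have b1 := beta_gt0 tT.
have bb := beta_nondecreasing coef tT.
have AE := AsumS t.
have ab := alpha_beta coef tT.
have a1 := alpha_ge0 coef tT.
have bL := beta_gtL coef tT.
have ES : model_error t.+1 = model_error t
    + (alpha t.+1 * dot (gradient_error y G t.+1) (y t.+1 - dual_center G t.+1)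
    + Asum alpha t.+1 * dot (gradient_error y G t.+1) (gradient_error y G t.+1)
      / (2 * (beta t.+1 - L))).
  by rewrite /model_error big_ord_recr.
have mS : model_min t.+1 = model_min t
    + beta t / 2 * dot (dual_center G t.+1) (dual_center G t.+1)
    + alpha t.+1 * (f (y t.+1) - dot (G t.+1) (y t.+1))
    - beta t.+1 / 2 * dot (dual_center G t.+2) (dual_center G t.+2).
  by rewrite /model_min big_ord_recr /= addrNK.
move: IH; rewrite {}ES {}mS; move: (model_min t) (model_error t) => m E.
have ez := dual_centerS tT.
have zE := scale_dual_centerS (ltnW tT).
have zE' := scale_dual_centerS tT.
rewrite {}ez in zE *.
move: (dual_center G t.+2) zE' => z' zE'.
have {}zE' : beta t.+1 *: z' = beta t *: z t - alpha t.+1 *: G t.+1.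
  by rewrite zE' zE big_ord_recr /= opprD.
have eE : G t.+1 - gradient f (y t.+1) = gradient_error y G t.+1 by [].
move: (gradient_error y G t.+1) eE => e eE IH.
move: eE zE' IH; set Gt := G t.+1; set yt := y t.+1 => eE zE' IH.
(* the model only grows when its curvature does *)
have grow : - (beta t / 2 * dot (z t) (z t)) + alpha t.+1 * dot Gt (z t)
      - alpha t.+1 ^+ 2 / (2 * beta t) * dot Gt Gt <= - (beta t.+1 / 2 * dot z' z').
  have -> : beta t.+1 / 2 * dot z' z' =
      dot (beta t.+1 *: z') (beta t.+1 *: z') / (2 * beta t.+1).
    by rewrite !dotE; field; apply: lt0r_neq0.
  have : dot (beta t *: z t - alpha t.+1 *: Gt) (beta t *: z t - alpha t.+1 *: Gt) / (2 * beta t.+1)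
      <= dot (beta t *: z t - alpha t.+1 *: Gt) (beta t *: z t - alpha t.+1 *: Gt) / (2 * beta t).
    apply: ler_wpM2l; first exact: dot_ge0.
    by rewrite lef_pV2 ?posrE ?mulr_gt0 // ler_pM2l.
  rewrite zE' => le1; rewrite -[leLHS]opprK lerN2; apply: le_trans le1 _.
  rewrite !dotE (dotC (z t) Gt) le_eqVlt; apply/orP; left; apply/eqP.
  by field; apply: lt0r_neq0.
(* convexity between x_t and the query point; A_t (x_t - y) is -alpha (z_t - y)
   because y is the weighted average of the two *)
have lower : Asum alpha t * f yt - alpha t.+1 * dot (Gt - e) (z t - yt)
     <= Asum alpha t * f (x t).
  have -> : Gt - e = gradient f yt by rewrite -eE opprB addrC subrK.
  have := convex_lower fdiff fconv fLip yt (x t - yt).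
  rewrite [yt + _]addrC subrK => /(ler_wpM2l (ltW A0)) => h.
  apply: le_trans h; rewrite mulrDr lerD2l -mulrN -dotNr -!dotZr.
  have -> : alpha t.+1 *: - (z t - yt) = Asum alpha t *: (x t - yt); last exact: lexx.
  rewrite /yt (primal_y method tT) /tau.
  apply/rowP => i; rewrite !mxE AE; field.
  by rewrite -AE; apply: lt0r_neq0.
(* the averaging turns the dual step into a gradient step from the query point *)
have xE : x t.+1 = yt - (alpha t.+1 ^+ 2 / (Asum alpha t.+1 * beta t)) *: Gt.
  rewrite (primal_x method tT) (primal_yhat method tT) /yt (primal_y method tT) /tau.
  apply/rowP => i; rewrite !mxE; field.
  by rewrite !lt0r_neq0.
have s0 : 0 <= alpha t.+1 ^+ 2 / (Asum alpha t.+1 * beta t).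
  by rewrite divr_ge0 ?sqr_ge0 // mulr_ge0 ?ltW.
have bs : beta t.+1 * (alpha t.+1 ^+ 2 / (Asum alpha t.+1 * beta t)) <= 1.
  rewrite mulrA ler_pdivrMr ?mulr_gt0 // mul1r mulrC.
  by rewrite [leRHS]mulrC.
have := inexact_gradient_step yt Gt bL s0 bs.
rewrite -xE => /(ler_wpM2l (ltW A1)) step; apply: le_trans step _.
rewrite eE mulrDr mulrBr.
have -> : Asum alpha t.+1 * (alpha t.+1 ^+ 2 / (Asum alpha t.+1 * beta t) / 2 * dot Gt Gt)
   = alpha t.+1 ^+ 2 / (2 * beta t) * dot Gt Gt.
  by field; rewrite !lt0r_neq0.
clearbody Gt yt.
move: lower grow IH; rewrite AE !dotE !mulrA.
lra.
Qed.

(** Estimating-sequence inequality: one dual model, minimised at the dual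
    centre, dominates the weighted objective from above and lies below it at
    [xs] up to the accumulated noise. *)
Lemma primal_potential (xs : 'rV[R]_n) t : (t <= T)%N ->
  Asum alpha t * (f (x t) - f xs)
    + beta t / 2 * dot (xs - dual_center G t.+1) (xs - dual_center G t.+1)
  <= beta t / 2 * dot xs xs + noise xs y G t.+1.
Proof.
move=> tT; have := model_invariant tT; rewrite /model_min => inv.
have zE := scale_dual_centerS tT.
have sumA : Asum alpha t * f xs = \sum_(i < t.+1) alpha i * f xs by rewrite mulr_suml.
have below : \sum_(i < t.+1) alpha i * (f (y i) - dot (G i) (y i))
     - beta t * dot (dual_center G t.+1) xs + model_error t
  <= Asum alpha t * f xs + noise xs y G t.+1.
  rewrite -dotZl zE dotNl opprK.
  have -> : dot (\sum_(i < t.+1) alpha i *: G i) xs = \sum_(i < t.+1) alpha i * dot (G i) xs.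
    rewrite /dot; under eq_bigr do rewrite summxE mulr_suml.
    rewrite exchange_big /=; apply: eq_bigr => i _; rewrite mulr_sumr.
    by apply: eq_bigr => j _; rewrite mxE mulrA.
  rewrite sumA /model_error /noise -!big_split /=; apply: ler_sum => i _.
  have a0 : 0 <= alpha i by rewrite (alpha_ge0 coef) // (leq_trans _ tT) // -ltnS.
  have := convex_lower fdiff fconv fLip (y i) (xs - y i).
  rewrite [y i + _]addrC subrK => /(ler_wpM2l a0).
  have -> : gradient f (y i) = G i - gradient_error y G i.
    by rewrite /gradient_error opprB addrC subrK.
  move: (gradient_error y G i) => e.
  rewrite !dotE => h; lra.
move: inv below; move: (dual_center G t.+1) => w inv below.
rewrite !dotE (dotC xs w).
lra.
Qed.

End PrimalPotential.

(** * Scalar exponential inequalities *)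

Section ScalarBounds.
Context {R : realType}.
Implicit Types x y : R.

(** The function [(1 + x + x^2) e^(-x)] has derivative [x (1 - x) e^(-x)], so
    on [x <= 1] it is smallest at the origin. *)
Lemma expR_le_quadratic x : x <= 1 -> expR x <= 1 + x + x ^+ 2.
Proof.
move=> x1.
pose h (t : R) : R := (1 + t + t ^+ 2) * expR (- t).
have dh (t : R) : is_derive t 1 h (t * (1 - t) * expR (- t)).
  have dE : is_derive t 1 (fun t : R => expR (- t)) (expR (- t) * (- 1)).
    exact: (@is_derive1_comp _ expR -%R t).
  apply: is_derive_eq; rewrite /GRing.scale /=; ring.
have ch (A : set R) : {within A, continuous h}.
  apply: continuous_subspaceT => s.
  by apply/differentiable_continuous/derivable1_diffP; have [] := dh s.
have h0 : h 0 = 1 by rewrite /h oppr0 expR0 expr0n /= !addr0 mulr1.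
suff : 1 <= h x.
  by rewrite /h expRN ler_pdivlMr ?expR_gt0 // mul1r.
rewrite -h0 -subr_ge0; case: (ltgtP x 0) => [xn|xp|->]; last by rewrite subrr.
- have [c /andP[]] := MVT xn (fun t _ => dh t) (ch _).
  rewrite !bnd_simp => xc c0; rewrite -[h x - h 0]opprB => ->.
  have hc : c * (1 - c) * expR (- c) <= 0.
    by apply: mulr_le0_ge0; [nra|exact: expR_ge0].
  nra.
- have [c /andP[]] := MVT xp (fun t _ => dh t) (ch _).
  rewrite !bnd_simp => c0 cx ->.
  rewrite subr0 !mulr_ge0 ?expR_ge0 //; lra.
Qed.

(** Both sides agree to first order at the origin. For [x > 1] the exponent
    [x^2] exceeds [x]; for [x < -1] the left side is below one. *)
Lemma expR_le_addsqr x : expR x <= x + expR (x ^+ 2).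
Proof.
have h2 := expR_ge1Dx (x ^+ 2).
case: (lerP x 1) => [x1|x1].
  have [xm|xm] := lerP (-1) x; first by have := expR_le_quadratic x1; lra.
  have : expR x <= 1 by rewrite expR_le1; lra.
  nra.
have : expR x <= expR (x ^+ 2) by rewrite ler_expR; nra.
lra.
Qed.

(** The linear term [x] carries no factor depending on [y], hence it averages
    to zero when [x] is a centred variable, even if [y] depends on it. *)
Lemma expRD_le_addsqr x y : 0 <= y -> expR (x + y) <= x + expR (x ^+ 2 + 2 * y).
Proof.
move=> y0.
have e1 : 1 <= expR y by rewrite -expR0 ler_expR.
have h := expR_le_addsqr x.
have h2 : 1 + x ^+ 2 <= expR (x ^+ 2) by exact: expR_ge1Dx.
have -> : x ^+ 2 + 2 * y = x ^+ 2 + y + y by ring.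
rewrite !expRD.
have h3 : expR x * expR y <= (x + expR (x ^+ 2)) * expR y by rewrite ler_wpM2r // expR_ge0.
have h4 : x <= expR (x ^+ 2) * expR y.
  apply: (@le_trans _ _ (expR (x ^+ 2))); last by rewrite ler_peMr ?expR_ge0.
  by have := sqr_ge0 (x - 1 / 2); lra.
have : x * (expR y - 1) <= expR (x ^+ 2) * expR y * (expR y - 1).
  by rewrite ler_wpM2r // subr_ge0.
nra.
Qed.

(** Chord bound with equality at [y = 1]: integrated once against a variable
    with [E e^Y <= e] it gives [E e^(xY) <= e^x], which is Jensen's inequality
    for the power [x]. *)
Lemma expR_interpolation x y : 0 <= x <= 1 ->
  expR (x * y) <= expR x * (x * (expR y / expR 1) + (1 - x)).
Proof.
move=> /andP[x0 x1].
have -> : x * y = x + x * (y - 1) by ring.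
rewrite expRD ler_pM2l ?expR_gt0 // -expRB.
have := convex_expR (Itv01 x0 x1) (y - 1 : R^o) (0 : R^o).
by rewrite !convRE /= /unstable.onem mulr0 addr0 expR0 mulr1.
Qed.

(** Bernoulli's inequality for [(1 - 1/64)^64]. *)
Lemma expR1_lt_11div4 : expR 1 <= 11 / 4 :> R.
Proof.
have h : 63 / 64 <= expR (- (1 / 64)) :> R by have := expR_ge1Dx (- (1 / 64) : R); lra.
have : (63 / 64) ^+ 64 <= expR (-1) :> R.
  have -> : (-1 : R) = 64%:R * - (1 / 64) by field.
  by rewrite expRM_natl; apply: lerXn2r; rewrite ?nnegrE ?expR_ge0 //; lra.
have h2 : 4 / 11 <= (63 / 64 : R) ^+ 64 by rewrite expr_div_n; lra.
rewrite expRN => /(le_trans h2) h3.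
by rewrite -[expR 1]invrK -[11 / 4]invrK lef_pV2 ?posrE ?invr_gt0 ?expR_gt0 //; lra.
Qed.

End ScalarBounds.

(** * Exponential moments of sums of independent vectors *)

Section SumBudget.
Context {R : realType} {n : nat}.
Implicit Types u S : 'rV[R]_n.
Implicit Types (a kappa s v : R) (m : nat).

(** Bound on the log-mgf [ln E exp(<u,S> + kappa |S|^2)] of a sum [S] of
    independent centred vectors of total variance proxy [v], with
    [a = |u|^2]. The denominator is the price of the quadratic term: absorbing
    one summand of proxy [s] multiplies [kappa] and [u] by [1 + 4 kappa s]. *)
Definition mgf_budget (a kappa v : R) : R := (a + 2 * kappa) * v / (1 - 4 * kappa * v).

(** One summand has been averaged out: its contribution is again the
    exponential of a quadratic form in the remaining sum [S], with [u] and
    [kappa] multiplied by [1 + 4 kappa s]. *)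
Lemma quadratic_peel u S kappa s :
  dot u S + kappa * dot S S
    + (dot (u + 2 * kappa *: S) (u + 2 * kappa *: S) + 2 * kappa) * s
  = dot ((1 + 4 * kappa * s) *: u) S + kappa * (1 + 4 * kappa * s) * dot S S
    + (dot u u + 2 * kappa) * s.
Proof. rewrite !dotE (dotC S u); ring. Qed.

Lemma mgf_budget_range kappa s m : 0 <= kappa -> 0 <= s ->
  4 * kappa * (m.+1%:R * s) < 1 ->
  4 * (kappa * (1 + 4 * kappa * s)) * (m%:R * s) < 1.
Proof.
move=> k0 s0 h.
have q0 : 0 <= 4 * kappa * s by rewrite !mulr_ge0.
have m0 : 0 <= m%:R :> R by [].
have -> : 4 * (kappa * (1 + 4 * kappa * s)) * (m%:R * s)
   = (1 + 4 * kappa * s) * (4 * kappa * s * m%:R) by ring.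
have e : 4 * kappa * (m.+1%:R * s) = 4 * kappa * s * m%:R + 4 * kappa * s.
  by rewrite mulrSr; ring.
rewrite {}e in h.
move: (4 * kappa * s) h q0 => q h q0.
have := mulr_ge0 q0 m0; nra.
Qed.

(** The budget is a supersolution of the recursion of [quadratic_peel]: with
    [q = 4 kappa s] the claim clears to [0 <= q]. *)
Lemma mgf_budget_step a kappa s m : 0 <= a -> 0 <= kappa -> 0 <= s ->
  4 * kappa * (m.+1%:R * s) < 1 ->
  (a + 2 * kappa) * s
    + mgf_budget ((1 + 4 * kappa * s) ^+ 2 * a) (kappa * (1 + 4 * kappa * s)) (m%:R * s)
  <= mgf_budget a kappa (m.+1%:R * s).
Proof.
move=> a0 k0 s0 h; rewrite /mgf_budget.
have h' := mgf_budget_range k0 s0 h.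
have D0 : 0 < 1 - 4 * kappa * (m.+1%:R * s) by lra.
have D1 : 0 < 1 - 4 * (kappa * (1 + 4 * kappa * s)) * (m%:R * s) by lra.
have m0 : 0 <= m%:R :> R by [].
have q0 : 0 <= 4 * kappa * s by rewrite !mulr_ge0.
set q := 4 * kappa * s in q0 *.
set D' := 1 - 4 * (kappa * (1 + q)) * (m%:R * s) in D1 *.
have D'E : D' = 1 - q * (1 + q) * m%:R by rewrite /D' /q; ring.
have DE : 1 - 4 * kappa * (m.+1%:R * s) = 1 - q * (m%:R + 1).
  by rewrite /q mulrSr; ring.
rewrite DE in D0 *.
(* the quadratic coefficient 2 kappa grows slower than |u|^2 *)
apply: (@le_trans _ _ ((a + 2 * kappa) * s * (1 + (1 + q) ^+ 2 * m%:R / D'))).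
  rewrite [leRHS]mulrDr mulr1 lerD2l [leRHS]mulrA ler_pM2r ?invr_gt0 //.
  have -> : (a + 2 * kappa) * s * ((1 + q) ^+ 2 * m%:R)
          = ((1 + q) ^+ 2 * a + 2 * (kappa * (1 + q) ^+ 2)) * (m%:R * s) by ring.
  apply: ler_wpM2r; first by rewrite mulr_ge0.
  rewrite lerD2l ler_pM2l // ler_wpM2l // expr2 ler_peMl; lra.
have -> : (a + 2 * kappa) * (m.+1%:R * s) / (1 - q * (m%:R + 1))
   = (a + 2 * kappa) * s * ((m%:R + 1) / (1 - q * (m%:R + 1))).
  by rewrite mulrSr; ring.
apply: ler_wpM2l; first by rewrite mulr_ge0 // addr_ge0 // mulr_ge0.
rewrite ler_pdivlMr // -(ler_pM2l D1).
have -> : D' * ((1 + (1 + q) ^+ 2 * m%:R / D') * (1 - q * (m%:R + 1)))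
   = (D' + (1 + q) ^+ 2 * m%:R) * (1 - q * (m%:R + 1)).
  by field; apply: lt0r_neq0.
rewrite D'E; nra.
Qed.

End SumBudget.

Section DiscreteSum.
Context {R : realType} {n : nat} {C : finType}.
Variables (q : C -> R) (X : C -> 'rV[R]_n) (rho : R).
Hypothesis q_ge0 : forall c, 0 <= q c.
Hypothesis q_sum : \sum_c q c = 1.
Hypothesis X_mean : \sum_c q c *: X c = 0.
Hypothesis X_bound : forall c, dot (X c) (X c) <= rho.

Lemma discrete_mgf (u : 'rV[R]_n) (kappa : R) : 0 <= kappa ->
  \sum_c q c * expR (dot u (X c) + kappa * dot (X c) (X c))
    <= expR ((dot u u + 2 * kappa) * rho).
Proof.
move=> k0.
have mean0 : \sum_c q c * dot u (X c) = 0.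
  transitivity (dot u (\sum_c q c *: X c)); last by rewrite X_mean dot0r.
  rewrite /dot; under [RHS]eq_bigr do rewrite summxE mulr_sumr.
  rewrite exchange_big /=; apply: eq_bigr => c _; rewrite mulr_sumr.
  by apply: eq_bigr => i _; rewrite mxE mulrCA.
apply: (@le_trans _ _ (\sum_c (q c * dot u (X c)
    + q c * expR ((dot u u + 2 * kappa) * rho)))); last first.
  by rewrite big_split /= mean0 add0r -mulr_suml q_sum mul1r.
apply: ler_sum => c _; rewrite -mulrDr; apply: ler_wpM2l => //.
have kX : 0 <= kappa * dot (X c) (X c) by rewrite mulr_ge0 ?dot_ge0.
apply: le_trans (expRD_le_addsqr _ kX) _.
rewrite lerD2l ler_expR [leRHS]mulrDl -[2 * kappa * rho]mulrA; apply: lerD.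
  by apply: le_trans (sqr_dot_le _ _) _; rewrite ler_wpM2l ?dot_ge0.
by rewrite ler_wpM2l // ler_wpM2l.
Qed.

(** Dimension-free concentration of a sum of i.i.d. vectors, quadratic term
    included: the first summand is averaged out with the others fixed. *)
Lemma discrete_sum_mgf m (u : 'rV[R]_n) (kappa : R) : 0 <= kappa -> 0 <= rho ->
  4 * kappa * (m%:R * rho) < 1 ->
  \sum_(c : m.-tuple C) (\prod_(j < m) q (tnth c j))
     * expR (dot u (\sum_(j < m) X (tnth c j))
        + kappa * dot (\sum_(j < m) X (tnth c j)) (\sum_(j < m) X (tnth c j)))
  <= expR (mgf_budget (dot u u) kappa (m%:R * rho)).
Proof.
move=> + rho0; elim: m u kappa => [|m IH] u kappa k0 range.
  rewrite /mgf_budget mul0r mulr0 mul0r expR0.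
  rewrite (big_pred1 [tuple]) => [|c]; last by apply/esym/eqP; exact: tuple0.
  by rewrite !big_ord0 !dotE mulr0 addr0 expR0 mulr1.
rewrite (reindex (fun p : C * m.-tuple C => [tuple of p.1 :: p.2])) /=; last first.
  exists (fun c : m.+1.-tuple C => (thead c, [tuple of behead c])).
    by move=> [c cs] _ /=; congr pair; apply: val_inj.
  by move=> c _ /=; rewrite -tuple_eta.
rewrite -(pair_bigA _ (fun c (cs : m.-tuple C) =>
  (\prod_(j < m.+1) q (tnth [tuple of c :: cs] j))
     * expR (dot u (\sum_(j < m.+1) X (tnth [tuple of c :: cs] j))
        + kappa * dot (\sum_(j < m.+1) X (tnth [tuple of c :: cs] j))
                      (\sum_(j < m.+1) X (tnth [tuple of c :: cs] j))))) /=.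
rewrite exchange_big /=.
pose S (cs : m.-tuple C) := \sum_(j < m) X (tnth cs j).
pose k' := kappa * (1 + 4 * kappa * rho).
pose u' := (1 + 4 * kappa * rho) *: u.
have k'0 : 0 <= k' by rewrite mulr_ge0 // addr_ge0 // !mulr_ge0.
apply: (@le_trans _ _ (\sum_(cs : m.-tuple C) (\prod_(j < m) q (tnth cs j))
   * expR (dot u' (S cs) + k' * dot (S cs) (S cs)) * expR ((dot u u + 2 * kappa) * rho))).
  apply: ler_sum => cs _.
  have peel c : (\prod_(j < m.+1) q (tnth [tuple of c :: cs] j))
     * expR (dot u (\sum_(j < m.+1) X (tnth [tuple of c :: cs] j))
        + kappa * dot (\sum_(j < m.+1) X (tnth [tuple of c :: cs] j))
                      (\sum_(j < m.+1) X (tnth [tuple of c :: cs] j)))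
     = (\prod_(j < m) q (tnth cs j)) * expR (dot u (S cs) + kappa * dot (S cs) (S cs))
       * (q c * expR (dot (u + 2 * kappa *: S cs) (X c) + kappa * dot (X c) (X c))).
    rewrite !big_ord_recl tnth0.
    have tS (j : 'I_m) : tnth [tuple of c :: cs] (lift ord0 j) = tnth cs j.
      by rewrite tnthS.
    under eq_bigr do rewrite tS.
    under [\sum_(j < m) _]eq_bigr do rewrite tS.
    rewrite -/(S cs).
    rewrite mulrACA -expRD [q c * _]mulrC; congr (_ * expR _).
    by rewrite !dotE (dotC (S cs) (X c)); ring.
  under eq_bigr do rewrite peel.
  rewrite -mulr_sumr -[leRHS]mulrA -expRD -quadratic_peel [X in _ <= _ * X]expRD [leRHS]mulrA.
  apply: ler_wpM2l; last exact: discrete_mgf.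
  by rewrite mulr_ge0 ?expR_ge0 // prodr_ge0.
rewrite -mulr_suml.
apply: (@le_trans _ _ (expR (mgf_budget (dot u' u') k' (m%:R * rho)) * expR ((dot u u + 2 * kappa) * rho))).
  by apply: ler_wpM2r; [exact: expR_ge0|apply: IH => //; exact: mgf_budget_range].
rewrite -expRD ler_expR addrC /u' !dotE mulrA -expr2.
by apply: mgf_budget_step => //; exact: dot_ge0.
Qed.

End DiscreteSum.

(** * Freezing and conditional densities *)

Section SubSigmaAlgebra.
Context {d} {Omega : measurableType d} {dY} {Y : measurableType dY}.

Lemma measurable_fun_finer (G : set (set Omega)) (f : g_sigma_algebraType G -> Y) :
  G `<=` @measurable _ Omega ->
  measurable_fun setT f -> measurable_fun (setT : set Omega) (f : Omega -> Y).
Proof.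
move=> GM mf _ A mA; rewrite setTI.
have := mf measurableT A mA; rewrite setTI.
by apply: smallest_sub => //; exact: sigma_algebra_measurable.
Qed.

Lemma measurable_fun_generator (G G' : set (set Omega))
    (f : g_sigma_algebraType G -> Y) :
  G `<=` <<s G' >> -> measurable_fun setT f ->
  measurable_fun setT (f : g_sigma_algebraType G' -> Y).
Proof.
move=> GG' mf _ A mA; rewrite setTI.
have := mf measurableT A mA; rewrite setTI.
by apply: smallest_sub => //; exact: smallest_sigma_algebra.
Qed.

End SubSigmaAlgebra.

Section Freezing.
Context {R : realType} {d} {Omega : measurableType d} (P : probability Omega R).
Context {dX} {Xi : measurableType dX} (mu : probability Xi R).
Variables (G : set (set Omega)) (U : Omega -> Xi).
Hypothesis G_measurable : G `<=` @measurable _ Omega.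
Hypothesis G_setI : setI_closed G.
Hypothesis G_setT : G setT.
Hypothesis U_measurable : measurable_fun setT U.
Hypothesis U_indep : forall A C, G A -> measurable C ->
  (P (A `&` U @^-1` C) = P A * mu C)%E.

(** Both sides are finite measures in [A] that agree on a generating
    pi-system. *)
Lemma independent_sigma_algebra A C : <<s G >> A -> measurable C ->
  (P (A `&` U @^-1` C) = P A * mu C)%E.
Proof.
move=> GA mC.
have mUC : measurable (U @^-1` C) by rewrite -[X in measurable X]setTI; exact: U_measurable.
have muC0 : 0 <= fine (mu C) by exact: fine_ge0.
have muCE : mu C = (fine (mu C))%:E by rewrite fineK // fin_num_measure.
have cover : \bigcup_(k : nat) [set: Omega] = setT.
  by apply/seteqP; split=> // w _; exists 0%N.
have := @g_sigma_algebra_measure_unique _ _ _ G G_measurable (fun=> setT)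
  (fun=> G_setT) cover (mrestr P mUC)
  (mscale (NngNum muC0) P) G_setI _ _ A GA.
have scaleE B : mscale (NngNum muC0) P B = (P B * mu C)%E.
  by rewrite muleC [in RHS]muCE.
rewrite /= scaleE; apply.
  by move=> B GB; rewrite /= scaleE -U_indep.
by move=> _; apply: le_lt_trans (ltry 1); apply: probability_le1; rewrite setTI.
Qed.

(** By independence the joint law of the past and of [U] is a product measure,
    and Tonelli's theorem integrates [U] out first. *)
Lemma integral_freeze (psi : g_sigma_algebraType G * Xi -> R) :
  measurable_fun [set: g_sigma_algebraType G * Xi] psi -> (forall p, 0 <= psi p) ->
  (\int[P]_w (psi (w, U w))%:E = \int[P]_w \int[mu]_c (psi (w, c))%:E)%E.
Proof.
move=> /measurable_EFinP mpsi psi0.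
have psi0E p : (0 <= (EFin \o psi) p)%E by rewrite lee_fin.
have mid : measurable_fun setT (fun w : Omega => w : g_sigma_algebraType G).
  move=> _ A mA; rewrite setTI.
  by move: mA; apply: smallest_sub => //; exact: sigma_algebra_measurable.
have mpair : measurable_fun setT (fun w : Omega => (w : g_sigma_algebraType G, U w)).
  exact: measurable_fun_pair.
pose idG : {mfun Omega >-> g_sigma_algebraType G} :=
  HB.pack (fun w : Omega => w : g_sigma_algebraType G) (isMeasurableFun.Build _ _ _ _ _ mid).
pose pairG : {mfun Omega >-> (g_sigma_algebraType G * Xi)%type} :=
  HB.pack (fun w : Omega => (w : g_sigma_algebraType G, U w)) (isMeasurableFun.Build _ _ _ _ _ mpair).
transitivity (\int[distribution P pairG]_p (psi p)%:E)%E.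
  by rewrite ge0_integral_distribution.
transitivity (\int[(distribution P idG \x mu)%E]_p (psi p)%:E)%E.
  apply: eq_measure_integral => A mA _; apply/esym.
  apply: product_measure_unique => // B C mB mC.
  by rewrite -independent_sigma_algebra.
rewrite (fubini_tonelli1 (EFin \o psi) mpsi psi0E) ge0_integral_distribution //.
  exact: measurable_fun_fubini_tonelli_F.
by move=> w; apply: integral_ge0 => c _.
Qed.

End Freezing.

Section ConditionalDensity.
Context {R : realType} {d} {Omega : measurableType d} (P : probability Omega R).
Variables (G : set (set Omega)) (p q : Omega -> R).
Hypothesis G_measurable : G `<=` @measurable _ Omega.
Hypotheses (p_measurable : measurable_fun setT p) (q_measurable : measurable_fun setT q).
Hypotheses (p_ge0 : forall w, 0 <= p w) (q_ge0 : forall w, 0 <= q w).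
Hypothesis pq : forall A, <<s G >> A ->
  (\int[P]_(w in A) (p w)%:E = \int[P]_(w in A) (q w)%:E)%E.

Import HBNNSimple.

Let sfun_density (F : {nnsfun g_sigma_algebraType G >-> R}) :
  (\int[P]_w (F w * p w)%:E = \int[P]_w (F w * q w)%:E)%E.
Proof.
have mF r : measurable (F @^-1` [set r] : set Omega).
  suff : <<s G >> (F @^-1` [set r]).
    by apply: smallest_sub => //; exact: sigma_algebra_measurable.
  exact: (@measurable_sfunP _ _ (g_sigma_algebraType G) _ F).
have expand (h : Omega -> R) : measurable_fun setT h -> (forall w, 0 <= h w) ->
  (\int[P]_w (F w * h w)%:E = \sum_(r \in range F)
     (r%:E * \int[P]_(w in F @^-1` [set r]) (h w)%:E))%E.
  move=> mh h0.
  have mrh r : measurable_fun setT (fun w : Omega => (r * \1_(F @^-1` [set r] : set Omega) w * h w)%:E).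
    apply/measurable_EFinP/measurable_funM => //; apply: measurable_funM => //.
  transitivity (\int[P]_w \sum_(r \in range F) (r * \1_(F @^-1` [set r]) w * h w)%:E)%E.
    apply: eq_integral => w _; rewrite fsumEFin //; congr EFin.
    by rewrite -mulr_fsuml -fimfunE.
  rewrite ge0_integral_fsum //; last first.
    move=> r w _; rewrite lee_fin mulr_ge0 //.
    by have := nnfun_muleindic_ge0 F r w; rewrite lee_fin.
  apply: eq_fsbigr => r rF.
  have r0 : 0 <= r by move: rF; rewrite inE => -[w _ <-].
  rewrite [in RHS]integral_mkcond -ge0_integralZl //.
  - apply: eq_integral => w _.
    rewrite patchE indicE; case: (_ \in _); first by rewrite mulr1 EFinM.
    by rewrite mulr0 mul0r mule0.
  - apply/measurable_restrict => //.
    by rewrite setTI; apply/measurable_EFinP; exact: measurable_funTS.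
  - by move=> w _; rewrite patchE; case: ifP => // _; rewrite lee_fin.
rewrite !expand //; apply: eq_fsbigr => r _; congr (_ * _)%E.
apply: pq; exact: (@measurable_sfunP _ _ (g_sigma_algebraType G) _ F).
Qed.

(** The hypothesis is the case of indicators; simple functions follow by
    linearity and nonnegative ones by monotone convergence. *)
Lemma integral_density (F : g_sigma_algebraType G -> R) :
  measurable_fun setT F -> (forall w, 0 <= F w) ->
  (\int[P]_w (F w * p w)%:E = \int[P]_w (F w * q w)%:E)%E.
Proof.
move=> mF F0.
have mEF : measurable_fun setT (EFin \o F) by exact/measurable_EFinP.
pose h := nnsfun_approx measurableT mEF.
have lim_ (g : Omega -> R) : measurable_fun setT g -> (forall w, 0 <= g w) ->
  (\int[P]_w (F w * g w)%:E = limn (fun m => \int[P]_w (h m w * g w)%:E))%E.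
  move=> mg g0.
  have mh m : measurable_fun (setT : set Omega) (h m : Omega -> R).
    exact: (@measurable_fun_finer _ Omega _ _ G).
  rewrite -monotone_convergence //; last 3 first.
  - by move=> m; apply/measurable_EFinP/measurable_funM.
  - by move=> m w _; rewrite lee_fin mulr_ge0.
  - move=> w _ a b ab; rewrite lee_fin ler_wpM2r //.
    exact/lefP/(nd_nnsfun_approx measurableT mEF).
  apply: eq_integral => w _; apply/esym/cvg_lim => //.
  have -> : (fun m => (h m w * g w)%:E) = (fun m => (EFin \o h m) w * (g w)%:E)%E.
    by apply/funext => m; rewrite EFinM.
  rewrite EFinM; apply: cvgeZr => //.
  by apply: cvg_nnsfun_approx => // v _; rewrite lee_fin.
rewrite !lim_ //; apply: congr_lim; apply/funext => m; exact: sfun_density.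
Qed.

End ConditionalDensity.

(** * Measurability of vectors, gradient and objective *)

Section VectorMeasurability.
Context {R : realType} {n : nat} {d} {T : measurableType d}.
Implicit Types u v : T -> 'rV[R]_n.

(** Measurability for the product sigma-algebra on the coordinates. *)
Definition vec_measurable v := forall i, measurable_fun setT (fun w => v w 0 i).

Lemma vec_measurable_cst (a : 'rV[R]_n) : vec_measurable (fun=> a).
Proof. by move=> i; exact: measurable_cst. Qed.

Lemma vec_measurableD u v : vec_measurable u -> vec_measurable v ->
  vec_measurable (fun w => u w + v w).
Proof.
move=> mu mv i; under eq_fun do rewrite mxE; exact: measurable_funD.
Qed.

Lemma vec_measurableZ (a : T -> R) v : measurable_fun setT a -> vec_measurable v ->
  vec_measurable (fun w => a w *: v w).
Proof.
move=> ma mv i; under eq_fun do rewrite mxE; exact: measurable_funM.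
Qed.

Lemma vec_measurableZl (a : R) v : vec_measurable v -> vec_measurable (fun w => a *: v w).
Proof. exact/vec_measurableZ/measurable_cst. Qed.

Lemma vec_measurableN v : vec_measurable v -> vec_measurable (fun w => - v w).
Proof.
by move=> mv; under eq_fun do rewrite -scaleN1r; exact: vec_measurableZl.
Qed.

Lemma vec_measurableB u v : vec_measurable u -> vec_measurable v ->
  vec_measurable (fun w => u w - v w).
Proof. by move=> mu mv; apply: vec_measurableD => //; exact: vec_measurableN. Qed.

Lemma vec_measurable_sum m (v : 'I_m -> T -> 'rV[R]_n) :
  (forall j, vec_measurable (v j)) -> vec_measurable (fun w => \sum_(j < m) v j w).
Proof.
move=> mv i; under eq_fun do rewrite summxE.
by apply: measurable_sum => j; exact: mv.
Qed.

Lemma measurable_dot u v : vec_measurable u -> vec_measurable v ->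
  measurable_fun setT (fun w => dot (u w) (v w)).
Proof.
by move=> mu mv; apply: measurable_sum => j; apply: measurable_funM.
Qed.

Lemma measurable_norm1 v : vec_measurable v -> measurable_fun setT (fun w => norm1 (v w)).
Proof. by move=> mv; apply: measurable_sum => j; exact: measurableT_comp. Qed.

Lemma vec_measurable_pos_part v : vec_measurable v -> vec_measurable (fun w => pos_part (v w)).
Proof.
move=> mv i; under eq_fun do rewrite mxE; exact: measurable_maxr.
Qed.

Lemma measurable_expR_comp (a : T -> R) : measurable_fun setT a ->
  measurable_fun setT (fun w => expR (a w)).
Proof. by move=> ma; apply: measurableT_comp => //; exact: measurable_expR. Qed.

End VectorMeasurability.

Section OracleMeasurability.
Context {R : realType} {n : nat} {dX} {Xi : measurableType dX} (mu : probability Xi R).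
Variables (g : 'rV[R]_n -> Xi -> 'rV[R]_n) (f : 'rV[R]_n -> R) (sigma B : R).
Hypothesis oracle : stochastic_oracle mu g f sigma B.
Context {d} {T : measurableType d}.

Lemma measurable_coords (y : T -> 'rV[R]_n) : vec_measurable y ->
  measurable_fun setT (fun w => [tuple y w 0 j | j < n]).
Proof.
move=> my; apply/measurable_fun_tnthP => j.
rewrite (_ : _ \o _ = fun w => y w 0 j) //.
by apply/funext => w /=; rewrite tnth_mktuple.
Qed.

Lemma vec_measurable_oracle (y : T -> 'rV[R]_n) (U : T -> Xi) :
  vec_measurable y -> measurable_fun setT U -> vec_measurable (fun w => g (y w) (U w)).
Proof.
move=> my mU i.
have mp : measurable_fun setT (fun w : T => ([tuple y w 0 j | j < n], U w)).
  by apply: measurable_fun_pair => //; exact: measurable_coords.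
have -> : (fun w => g (y w) (U w) 0 i) =
   (fun p : n.-tuple R * Xi => g (\row_(j < n) tnth p.1 j) p.2 0 i)
     \o (fun w => ([tuple y w 0 j | j < n], U w)).
  apply/funext => w /=; congr (g _ _ 0 i).
  by apply/rowP => j; rewrite mxE tnth_mktuple.
exact: measurableT_comp (oracle_measurable oracle i) mp.
Qed.

Lemma oracle_coord_bound x c i : `|g x c 0 i| <= B.
Proof.
apply: le_trans (oracle_bounded oracle x c); rewrite /norm1 (bigD1 i) //=.
by rewrite lerDl sumr_ge0.
Qed.

Lemma bounded_integrable (h : Xi -> R) K : measurable_fun setT h ->
  (forall c, `|h c| <= K) -> mu.-integrable setT (EFin \o h).
Proof.
move=> mh hK; apply: measurable_bounded_integrable => //.
  by apply: le_lt_trans (ltry 1); exact: probability_le1.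
exists K; split; first exact: num_real.
by move=> M KM c _; apply: le_trans (hK c) (ltW KM).
Qed.

Lemma measurable_oracle_coord x i : measurable_fun setT (fun c => g x c 0 i).
Proof.
have -> : (fun c => g x c 0 i) =
   (fun p : n.-tuple R * Xi => g (\row_(j < n) tnth p.1 j) p.2 0 i)
     \o (fun c => ([tuple x 0 j | j < n], c)).
  apply/funext => w /=; congr (g _ _ 0 i).
  by apply/rowP => j; rewrite mxE tnth_mktuple.
apply: measurableT_comp (oracle_measurable oracle i) _.
by apply: measurable_fun_pair => //; exact: measurable_cst.
Qed.

(** The gradient is an average of the jointly measurable oracle. *)
Lemma vec_measurable_gradient (y : T -> 'rV[R]_n) :
  vec_measurable y -> vec_measurable (fun w => gradient f (y w)).
Proof.
move=> my i.
pose h (p : n.-tuple R * Xi) := g (\row_(j < n) tnth p.1 j) p.2 0 i + B.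
have mh : measurable_fun setT (EFin \o h).
  apply/measurable_EFinP/measurable_funD; last exact: measurable_cst.
  exact: oracle_measurable oracle i.
have h0 p : (0 <= (EFin \o h) p)%E.
  rewrite lee_fin /h -lerBlDr sub0r.
  by have := oracle_coord_bound (\row_(j < n) tnth p.1 j) p.2 i; rewrite ler_norml => /andP[].
have mF := @measurable_fun_fubini_tonelli_F _ _ _ _ _ mu (EFin \o h) mh h0.
have FE p : fubini_F mu (EFin \o h) p = (gradient f (\row_(j < n) tnth p j) 0 i + B)%:E.
  rewrite /fubini_F /= /h; under eq_integral do rewrite EFinD.
  rewrite integralD //.
  - rewrite integral_cst //= probability_setT mule1.
    have := oracle_unbiased oracle (\row_(j < n) tnth p j) i.
    by rewrite unlock => ->.
  - apply: (bounded_integrable (K := B)).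
      exact: (measurable_oracle_coord (\row_(j < n) tnth p j) i).
    by move=> c; exact: oracle_coord_bound.
  - by apply: (bounded_integrable (K := `|B|)).
have mG : measurable_fun setT (fun p : n.-tuple R => gradient f (\row_(j < n) tnth p j) 0 i).
  have -> : (fun p : n.-tuple R => gradient f (\row_(j < n) tnth p j) 0 i) =
     (fun p : n.-tuple R => fine (fubini_F mu (EFin \o h) p) - B).
    by apply/funext => p; rewrite FE /= addrK.
  apply: measurable_funB; last exact: measurable_cst.
  exact: measurableT_comp.
have -> : (fun w => gradient f (y w) 0 i) =
   (fun p : n.-tuple R => gradient f (\row_(j < n) tnth p j) 0 i)
    \o (fun w => [tuple y w 0 j | j < n]).
  apply/funext => w /=; congr (gradient f _ 0 i).
  by apply/rowP => j; rewrite mxE tnth_mktuple.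
by apply: measurableT_comp mG _; exact: measurable_coords.
Qed.

Hypothesis fdiff : forall x : 'rV[R]_n, differentiable f x.
Hypothesis fconv : @convex_function R 'rV[R]_n setT f.
Variable L : R.
Hypothesis fLip : forall x y : 'rV[R]_n,
  norm2 (gradient f x - gradient f y) <= L * norm2 (x - y).

Let riemann_sum (v : 'rV[R]_n) (m : nat) :=
  f 0 + \sum_(k < m.+1) dot (gradient f ((k%:R / m.+1%:R) *: v)) (m.+1%:R^-1 *: v).

Let riemann_sum_error v m :
  riemann_sum v m <= f v <= riemann_sum v m + L / 2 * dot v v * m.+1%:R^-1.
Proof.
pose N : R := m.+1%:R.
have N0 : 0 < N by rewrite ltr0n.
have step k : ((k.+1%:R / N) *: v) = (k%:R / N) *: v + N^-1 *: v.
  by rewrite -scalerDl -{3}[N^-1]mul1r -mulrDl mulrSr.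
have lo k : dot (gradient f ((k%:R / N) *: v)) (N^-1 *: v)
    <= f ((k.+1%:R / N) *: v) - f ((k%:R / N) *: v).
  by rewrite step lerBrDl; exact: convex_lower fLip _ _.
have up k : f ((k.+1%:R / N) *: v) - f ((k%:R / N) *: v)
    <= dot (gradient f ((k%:R / N) *: v)) (N^-1 *: v) + L / 2 * dot v v * N^-1 ^+ 2.
  have := smooth_upper fdiff fLip ((k%:R / N) *: v) (N^-1 *: v).
  rewrite -step => h; rewrite lerBlDl addrA; apply: le_trans h _.
  by rewrite !dotE le_eqVlt; apply/orP; left; apply/eqP; ring.
have tele : f v = f 0 + \sum_(k < m.+1) (f ((k.+1%:R / N) *: v) - f ((k%:R / N) *: v)).
  rewrite -(big_mkord xpredT (fun k => f ((k.+1%:R / N) *: v) - f ((k%:R / N) *: v))).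
  rewrite (telescope_sumr (fun k => f ((k%:R / N) *: v))) //.
  by rewrite mul0r scale0r divff ?lt0r_neq0 // scale1r addrC subrK.
rewrite tele /riemann_sum lerD2l ler_sum //= -addrA lerD2l.
apply: (@le_trans _ _ (\sum_(k < m.+1) (dot (gradient f ((k%:R / N) *: v)) (N^-1 *: v)
    + L / 2 * dot v v * N^-1 ^+ 2))); first by apply: ler_sum => k _; exact: up.
rewrite big_split /= lerD2l sumr_const card_ord -mulr_natr -/N expr2.
by rewrite le_eqVlt; apply/orP; left; apply/eqP; field; apply: lt0r_neq0.
Qed.

(** [f] is recovered from its gradient by Riemann sums along rays, so it
    inherits the measurability of the gradient. *)
Lemma measurable_objective (y : T -> 'rV[R]_n) :
  vec_measurable y -> measurable_fun setT (fun w => f (y w)).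
Proof.
move=> my; apply: (@measurable_fun_cvg _ _ _ _ (fun m w => riemann_sum (y w) m)).
  move=> m; apply: measurable_funD; first exact: measurable_cst.
  apply: measurable_sum => k; apply: measurable_dot; last exact: vec_measurableZl.
  by apply: vec_measurable_gradient; exact: vec_measurableZl.
move=> w _.
apply: (@squeeze_cvgr _ _ _ _ (fun m => f (y w) - L / 2 * dot (y w) (y w) * harmonic m)
  (fun _ => f (y w))).
- apply: nearW => m; have /andP[lo up] := riemann_sum_error (y w) m.
  by rewrite lo andbT lerBlDr.
- rewrite -[X in _ --> X]subr0 -[X in _ --> _ - X](mulr0 (L / 2 * dot (y w) (y w))).
  by apply: cvgB; [exact: cvg_cst|apply: cvgM; [exact: cvg_cst|exact: cvg_harmonic]].
- exact: cvg_cst.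
Qed.

End OracleMeasurability.

(** * Exponential moments of one oracle answer *)

Section RealIntegrals.
Context {R : realType} {d} {T : measurableType d} (P : probability T R).
Implicit Types h : T -> R.

Lemma le_integral_ge0 h1 h2 : measurable_fun setT h1 -> measurable_fun setT h2 ->
  (forall w, 0 <= h1 w) -> (forall w, h1 w <= h2 w) ->
  (\int[P]_w (h1 w)%:E <= \int[P]_w (h2 w)%:E)%E.
Proof.
move=> m1 m2 p1 h12; have mE h : measurable_fun setT h -> measurable_fun setT (fun w => (h w)%:E).
  by move=> mh; exact/measurable_EFinP.
apply: ge0_le_integral; [by []| |exact: mE|exact: mE|] => w _; rewrite lee_fin //.
Qed.

Lemma integral_scale h (b : R) : measurable_fun setT h -> (forall w, 0 <= h w) ->
  0 <= b -> (\int[P]_w (b * h w)%:E = b%:E * \int[P]_w (h w)%:E)%E.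
Proof.
move=> mh h0 b0; under eq_integral do rewrite EFinM.
have mE : measurable_fun setT (fun w => (h w)%:E) by exact/measurable_EFinP.
by rewrite ge0_integralZl // => w _; rewrite lee_fin.
Qed.

Lemma integral_affine h (a b : R) : measurable_fun setT h -> (forall w, 0 <= h w) ->
  0 <= a -> 0 <= b ->
  (\int[P]_w (a + b * h w)%:E = a%:E + b%:E * \int[P]_w (h w)%:E)%E.
Proof.
move=> mh h0 a0 b0; under eq_integral do rewrite EFinD.
have mE : measurable_fun setT (fun w => (b * h w)%:E).
  by apply/measurable_EFinP/measurable_funM.
rewrite ge0_integralD //; first by rewrite integral_cst //= probability_setT mule1 integral_scale.
by move=> w _; rewrite lee_fin mulr_ge0.
Qed.

End RealIntegrals.

Section OracleMgf.
Context {R : realType} {n : nat} {dX} {Xi : measurableType dX} (mu : probability Xi R).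
Variables (g : 'rV[R]_n -> Xi -> 'rV[R]_n) (f : 'rV[R]_n -> R) (sigma B : R).
Hypothesis sigma0 : 0 < sigma.
Hypothesis oracle : stochastic_oracle mu g f sigma B.

Let X x c := g x c - gradient f x.
Let s := sigma ^+ 2.
Let s0 : 0 < s. Proof. by rewrite exprn_gt0. Qed.

Lemma vec_measurable_oracle_error x : vec_measurable (X x).
Proof.
apply: vec_measurableB; last exact: vec_measurable_cst.
by move=> i; exact: (measurable_oracle_coord oracle).
Qed.

Let XE x c i : X x c 0 i = g x c 0 i - gradient f x 0 i.
Proof. by rewrite /X mxE [(- gradient f x) 0 i]mxE. Qed.

Let mX := vec_measurable_oracle_error.

Lemma oracle_error_mean x (v : 'rV[R]_n) :
  mu.-integrable setT (fun c => (dot v (X x c))%:E) /\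
  (\int[mu]_c (dot v (X x c))%:E = 0)%E.
Proof.
have bX i c : `|X x c 0 i| <= B + `|gradient f x 0 i|.
  rewrite XE; apply: le_trans (ler_normD _ _) _.
  by rewrite normrN lerD2r (oracle_coord_bound oracle).
have iX i : mu.-integrable setT (fun c => (X x c 0 i)%:E).
  exact: (bounded_integrable mu (mX x i) (bX i)).
have iv i : mu.-integrable setT (fun c => (v 0 i)%:E * (X x c 0 i)%:E)%E.
  exact: integrableZl.
have -> : (fun c => (dot v (X x c))%:E) =
    (fun c => \sum_(i < n) ((v 0 i)%:E * (X x c 0 i)%:E))%E.
  by apply/funext => c; rewrite /dot -sumEFin; apply: eq_bigr => i _; rewrite EFinM.
split; first exact: integrable_sum.
rewrite integral_sum // big1 // => i _; rewrite integralZl //.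
suff -> : (\int[mu]_c (X x c 0 i)%:E = 0)%E by rewrite mule0.
have ig : mu.-integrable setT (fun c => (g x c 0 i)%:E).
  apply: (bounded_integrable mu (K := B)); first exact: (measurable_oracle_coord oracle).
  by move=> c; exact: (oracle_coord_bound oracle).
under eq_integral => c _ do rewrite XE EFinB.
rewrite integralB //; last first.
  by apply: (bounded_integrable mu (K := `|gradient f x 0 i|)).
rewrite integral_cst //= probability_setT mule1.
by have := oracle_unbiased oracle x i; rewrite unlock => ->; rewrite subee.
Qed.

Let measurable_sq x : measurable_fun setT (fun c => dot (X x c) (X x c)).
Proof. exact: measurable_dot. Qed.

(** The light-tail assumption at exponent one implies it at every smaller
    exponent. *)
Lemma oracle_tail_power x (theta : R) : 0 <= theta <= 1 ->
  (\int[mu]_c (expR (theta * (dot (X x c) (X x c) / s)))%:E <= (expR theta)%:E)%E.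
Proof.
move=> /[dup] th /andP[t0 t1].
pose a := expR theta * (1 - theta); pose b := expR theta * theta / expR 1.
have a0 : 0 <= a by rewrite mulr_ge0 ?expR_ge0 // subr_ge0.
have b0 : 0 <= b by rewrite divr_ge0 ?expR_ge0 // mulr_ge0 ?expR_ge0.
have mh : measurable_fun setT (fun c => expR (dot (X x c) (X x c) / s)).
  by apply: measurable_expR_comp; apply: measurable_funM => //; exact: measurable_cst.
apply: (@le_trans _ _ (\int[mu]_c (a + b * expR (dot (X x c) (X x c) / s))%:E))%E.
  apply: le_integral_ge0.
  - by apply: measurable_expR_comp; apply: measurable_funM => //; exact: measurable_funM.
  - by apply: measurable_funD => //; exact: measurable_funM.
  - by move=> c; exact: expR_ge0.
  - move=> c; apply: le_trans (expR_interpolation _ th) _.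
    by rewrite /a /b le_eqVlt; apply/orP; left; apply/eqP; ring.
rewrite integral_affine //.
have tail : (\int[mu]_c (expR (dot (X x c) (X x c) / s))%:E <= (expR 1)%:E)%E.
  have := oracle_light_tail oracle x; rewrite unlock.
  by under eq_integral do rewrite sqr_norm2.
apply: (@le_trans _ _ (a%:E + b%:E * (expR 1)%:E)%E).
  by rewrite leeD2l // lee_wpmul2l // lee_fin.
rewrite -EFinM -EFinD lee_fin /a /b le_eqVlt; apply/orP; left; apply/eqP.
by field; rewrite gt_eqF ?expR_gt0.
Qed.

(** Small arguments: centring removes the linear term and Jensen's inequality
    handles the rest. Large arguments: Young's inequality already suffices,
    because the bound is then larger than the tail constant. *)
Lemma oracle_mgf x (v : 'rV[R]_n) (kappa : R) : 0 <= kappa -> kappa * s <= 1 / 2 ->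
  (\int[mu]_c (expR (dot v (X x c) + kappa * dot (X x c) (X x c)))%:E
    <= (expR ((dot v v + 2 * kappa) * s))%:E)%E.
Proof.
move=> k0 ks.
have [iv ev] := oracle_error_mean x v.
set V := (dot v v + 2 * kappa) * s.
have V0 : 0 <= V by rewrite mulr_ge0 ?(ltW s0) // addr_ge0 ?dot_ge0 // mulr_ge0.
have mlin : measurable_fun setT (fun c => dot v (X x c)).
  by apply: measurable_dot => //; exact: vec_measurable_cst.
have mexp : measurable_fun setT (fun c => expR (dot v (X x c) + kappa * dot (X x c) (X x c))).
  apply: measurable_expR_comp; apply: measurable_funD => //.
  by apply: measurable_funM => //; exact: measurable_cst.
have mtail t : measurable_fun setT (fun c => expR (t * (dot (X x c) (X x c) / s))).
  apply: measurable_expR_comp; apply: measurable_funM; first exact: measurable_cst.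
  by apply: measurable_funM => //; exact: measurable_cst.
have [V1|V1] := lerP V 1.
  have VV : 0 <= V <= 1 by rewrite V0.
  have it : mu.-integrable setT (fun c => (expR (V * (dot (X x c) (X x c) / s)))%:E).
    apply/integrableP; split; first exact/measurable_EFinP.
    under eq_integral do rewrite gee0_abs ?lee_fin ?expR_ge0 //.
    by apply: le_lt_trans (oracle_tail_power x VV) _; rewrite ltry.
  have pointwise c : expR (dot v (X x c) + kappa * dot (X x c) (X x c)) <=
     dot v (X x c) + expR (V * (dot (X x c) (X x c) / s)).
    apply: le_trans (expRD_le_addsqr _ _) _; first by rewrite mulr_ge0 ?dot_ge0.
    rewrite lerD2l ler_expR /V.
    have -> : (dot v v + 2 * kappa) * s * (dot (X x c) (X x c) / s)
      = dot v v * dot (X x c) (X x c) + 2 * (kappa * dot (X x c) (X x c)).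
      by field; apply: lt0r_neq0.
    by rewrite lerD2r sqr_dot_le.
  apply: (@le_trans _ _ (\int[mu]_c (dot v (X x c)
       + expR (V * (dot (X x c) (X x c) / s)))%:E))%E.
    by apply: le_integral_ge0 => //; exact: measurable_funD.
  under eq_integral do rewrite EFinD.
  by rewrite integralD // ev add0e; exact: oracle_tail_power.
have th : 0 <= 1 / 2 + kappa * s <= 1 by have := mulr_ge0 k0 (ltW s0); lra.
have pointwise c : expR (dot v (X x c) + kappa * dot (X x c) (X x c)) <=
   expR (dot v v * s / 2) * expR ((1 / 2 + kappa * s) * (dot (X x c) (X x c) / s)).
  rewrite -expRD ler_expR; move: (X x c) => e.
  have := dot_ge0 (s *: v - e); rewrite !dotE (dotC _ v).
  set p := dot v e; set q := dot e e => h.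
  have -> : (1 / 2 + kappa * s) * (q / s) = q / (2 * s) + kappa * q.
    by field; apply: lt0r_neq0.
  rewrite addrA lerD2r -(ler_pM2l s0).
  have -> : s * (dot v v * s / 2 + q / (2 * s)) = (s * (s * dot v v) + q) / 2.
    by field; apply: lt0r_neq0.
  lra.
apply: (@le_trans _ _ (\int[mu]_c (expR (dot v v * s / 2) *
    expR ((1 / 2 + kappa * s) * (dot (X x c) (X x c) / s)))%:E))%E.
  by apply: le_integral_ge0 => //; exact: measurable_funM.
rewrite integral_scale ?expR_ge0 //.
apply: (@le_trans _ _ ((expR (dot v v * s / 2))%:E * (expR (1 / 2 + kappa * s))%:E)%E).
  by rewrite lee_wpmul2l ?lee_fin ?expR_ge0 // oracle_tail_power.
rewrite -EFinM lee_fin -expRD ler_expR; move: V1; rewrite /V; lra.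
Qed.

End OracleMgf.

(** * Exponential moments of a minibatch *)

Section Batch.
Context {R : realType} {n : nat} {dX} {Xi : measurableType dX} (mu : probability Xi R).
Variables (g : 'rV[R]_n -> Xi -> 'rV[R]_n) (f : 'rV[R]_n -> R) (sigma B : R).
Hypothesis sigma0 : 0 < sigma.
Hypothesis oracle : stochastic_oracle mu g f sigma B.
Context {d} {Omega : measurableType d} (P : probability Omega R).
Variables (H : set (set Omega)) (r : nat) (U : nat -> Omega -> Xi).
Hypothesis H_measurable : H `<=` @measurable _ Omega.
Hypothesis U_measurable : forall i, (i < r)%N -> measurable_fun setT (U i).
Hypothesis batch_iid : forall (A : set Omega) (C : nat -> set Xi),
  <<s H >> A -> (forall i, measurable (C i)) ->
  (P (A `&` [set w | forall i, (i < r)%N -> C i (U i w)])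
    = P A * \prod_(i < r) mu (C i))%E.

Let past := g_sigma_algebraType H.

(** A pi-system generating the information of the past and of the first [m]
    samples; on it the law of the batch can be applied directly. *)
Let prefix_events m : set (set Omega) := [set E | exists A C,
  [/\ <<s H >> A, forall i, measurable (C i) &
      E = A `&` [set w | forall i, (i < m)%N -> C i (U i w)]]].

Let sigma_measurable A : <<s H >> A -> @measurable _ Omega A.
Proof. by apply: smallest_sub => //; exact: sigma_algebra_measurable. Qed.

Let prefix_measurable m : (m <= r)%N -> prefix_events m `<=` @measurable _ Omega.
Proof.
move=> mr _ [A [C [HA mC ->]]]; apply: measurableI; first exact: sigma_measurable.
have -> : [set w | forall i, (i < m)%N -> C i (U i w)] = \bigcap_(i < m) (U i @^-1` C i) by [].
apply: bigcap_measurableType => i im.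
by rewrite -[X in measurable X]setTI; apply: U_measurable => //; exact: leq_trans mr.
Qed.

Let prefix_setI m : setI_closed (prefix_events m).
Proof.
move=> _ _ [A [C [HA mC ->]]] [A' [C' [HA' mC' ->]]].
exists (A `&` A'), (fun i => C i `&` C' i); split.
- exact: (@measurableI _ past).
- by move=> i; exact: measurableI.
- apply/seteqP; split=> w /=.
    by move=> [[Aw h] [A'w h']]; split=> // i im; split; [exact: h|exact: h'].
  by move=> [[Aw A'w] h]; split; split=> // i /h [].
Qed.

Let prefix_past m A : <<s H >> A -> prefix_events m A.
Proof.
move=> HA; exists A, (fun=> setT); split=> //.
by apply/seteqP; split=> w //= [].
Qed.

Let prefix_sample m i : (i < m)%N ->
  measurable_fun (setT : set (g_sigma_algebraType (prefix_events m)))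
    (U i : g_sigma_algebraType (prefix_events m) -> Xi).
Proof.
move=> im _ D mD; rewrite setTI; apply: sub_sigma_algebra.
exists setT, (fun j => if j == i then D else setT); split.
- exact: (@measurableT _ past).
- by move=> j; case: ifP.
- apply/seteqP; split=> w /=.
    by move=> Dw; split=> // j _; case: ifP => // /eqP ->.
  by move=> [_ /(_ i im)]; rewrite eqxx.
Qed.

Let prefix_law m A C : (m <= r)%N -> <<s H >> A -> (forall i, measurable (C i)) ->
  (P (A `&` [set w | forall i, (i < m)%N -> C i (U i w)])
    = P A * \prod_(i < m) mu (C i))%E.
Proof.
move=> mr HA mC.
have := @batch_iid A (fun i => if (i < m)%N then C i else setT) HA.
have -> : [set w | forall i, (i < r)%N -> (if (i < m)%N then C i else setT) (U i w)]
   = [set w | forall i, (i < m)%N -> C i (U i w)].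
  apply/seteqP; split=> w /= h i.
    by move=> im; have := h i (leq_trans im mr); rewrite im.
  by move=> _; case: ifP => // /h.
move=> ->; last by move=> i; case: ifP.
congr (_ * _)%E.
(* the unconstrained samples contribute factors mu setT = 1 *)
rewrite -(big_mkord xpredT (fun i => mu (if (i < m)%N then C i else setT))).
have tail : (\prod_(m <= i < r) mu (if (i < m)%N then C i else setT) = 1)%E.
  rewrite big_nat_cond big1 // => i /andP[/andP[mi _] _].
  by rewrite ltnNge mi /= probability_setT.
rewrite (big_cat_nat (n := m)) //= tail mule1.
by rewrite big_mkord; apply: eq_bigr => i _; rewrite ltn_ord.
Qed.

Let next_sample_independent m A D : (m < r)%N -> prefix_events m A -> measurable D ->
  (P (A `&` U m @^-1` D) = P A * mu D)%E.
Proof.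
move=> mr [E [C [HE mC ->]]] mD.
rewrite (prefix_law (ltnW mr)) //.
pose C' i := if i == m then D else C i.
have -> : E `&` [set w | forall i, (i < m)%N -> C i (U i w)] `&` U m @^-1` D
    = E `&` [set w | forall i, (i < m.+1)%N -> C' i (U i w)].
  apply/seteqP; split=> w /=.
    move=> [[Ew h] Dw]; split=> // i; rewrite ltnS /C'.
    by case: eqP => [->//|/eqP im le]; apply: h; rewrite ltn_neqAle im.
  move=> [Ew h]; split; last by have := h m (ltnSn m); rewrite /C' eqxx.
  by split=> // i im; have := h i (ltnW im); rewrite /C' ltn_eqF.
rewrite prefix_law //; last by move=> i; rewrite /C'; case: ifP.
rewrite -muleA big_ord_recr /= /C' eqxx; congr (_ * (_ * _))%E.
by apply: eq_bigr => i _; rewrite ltn_eqF.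
Qed.

Let s := sigma ^+ 2.
Let s0 : 0 < s. Proof. by rewrite exprn_gt0. Qed.

Let batch_sum (y : Omega -> 'rV[R]_n) m w : 'rV[R]_n :=
  \sum_(i < m) (g (y w) (U i w) - gradient f (y w)).

Let past_prefix {dY} {Y : measurableType dY} m (h : past -> Y) : measurable_fun setT h ->
  measurable_fun setT (h : g_sigma_algebraType (prefix_events m) -> Y).
Proof.
apply: measurable_fun_generator => A HA; apply: sub_sigma_algebra.
by apply: prefix_past; exact: sub_sigma_algebra.
Qed.

Let batch_sum_measurable (y : past -> 'rV[R]_n) m : vec_measurable y ->
  @vec_measurable R n _ (g_sigma_algebraType (prefix_events m)) (batch_sum y m).
Proof.
move=> my; apply: vec_measurable_sum => i; apply: vec_measurableB.
  apply: (vec_measurable_oracle oracle); last exact: prefix_sample.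
  by move=> j; exact: past_prefix.
apply: (vec_measurable_gradient oracle).
by move=> j; exact: past_prefix.
Qed.

(** The last sample is independent of the past and of the samples before it, so
    it can be averaged out with everything else frozen; what is left has the
    same shape with modified weight [A], direction [u] and [kappa]. *)
Lemma batch_sum_mgf (y u : past -> 'rV[R]_n) (A : past -> R) (kappa : R) m :
  (m <= r)%N -> vec_measurable y -> vec_measurable u -> measurable_fun setT A ->
  (forall w, 0 <= A w) -> 0 <= kappa -> 4 * kappa * (m%:R * s) < 1 ->
  (\int[P]_w (A w * expR (dot (u w) (batch_sum y m w)
                  + kappa * dot (batch_sum y m w) (batch_sum y m w)))%:E
   <= \int[P]_w (A w * expR (mgf_budget (dot (u w) (u w)) kappa (m%:R * s)))%:E)%E.
Proof.
elim: m u A kappa => [|m IH] u A kappa mr my mu_ mA A0 k0 range.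
  rewrite le_eqVlt; apply/orP; left; apply/eqP; apply: eq_integral => w _.
  by rewrite /batch_sum big_ord0 !dotE mulr0 addr0 /mgf_budget mul0r mulr0 mul0r.
pose F := g_sigma_algebraType (prefix_events m).
have mS : @vec_measurable R n _ F (batch_sum y m) by exact: batch_sum_measurable.
pose v (w : F) := u w + 2 * kappa *: batch_sum y m w.
pose Phi (w : F) := A w * expR (dot (u w) (batch_sum y m w)
                  + kappa * dot (batch_sum y m w) (batch_sum y m w)).
have muF : @vec_measurable R n _ F u by move=> j; exact: past_prefix.
have myF : @vec_measurable R n _ F y by move=> j; exact: past_prefix.
have mAF : measurable_fun setT (A : F -> R) by exact: past_prefix.
have mv : @vec_measurable R n _ F v.
  by apply: vec_measurableD => //; exact: vec_measurableZl.
have mPhi : measurable_fun setT Phi.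
  apply: measurable_funM => //; apply: measurable_expR_comp; apply: measurable_funD.
    exact: measurable_dot.
  by apply: measurable_funM => //; exact: measurable_dot.
have Phi0 w : 0 <= Phi w by rewrite mulr_ge0 ?expR_ge0.
pose E (p : F * Xi) := g (y p.1) p.2 - gradient f (y p.1).
pose psi (p : F * Xi) := Phi p.1 * expR (dot (v p.1) (E p) + kappa * dot (E p) (E p)).
have fstv (h : F -> 'rV[R]_n) : vec_measurable h ->
  @vec_measurable R n _ (F * Xi)%type (fun p => h p.1).
  by move=> mh j; exact: measurableT_comp (mh j) measurable_fst.
have mE : @vec_measurable R n _ (F * Xi)%type E.
  apply: vec_measurableB.
    by apply: (vec_measurable_oracle oracle) => //; exact: fstv.
  by apply: (vec_measurable_gradient oracle); exact: fstv.
have mpsi : measurable_fun [set: F * Xi] psi.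
  apply: measurable_funM; first exact: measurableT_comp mPhi measurable_fst.
  apply: measurable_expR_comp; apply: measurable_funD.
    exact: (measurable_dot (fstv v mv) mE).
  by apply: measurable_funM => //; exact: measurable_dot.
have psi0 p : 0 <= psi p by rewrite mulr_ge0 ?expR_ge0.
have freeze := integral_freeze (prefix_measurable (ltnW mr)) (@prefix_setI m)
  (prefix_past m (@measurableT _ past)) (U_measurable mr)
  (fun A D => @next_sample_independent m A D mr) mpsi psi0.
have peel w : A w * expR (dot (u w) (batch_sum y m.+1 w)
     + kappa * dot (batch_sum y m.+1 w) (batch_sum y m.+1 w)) = psi (w, U m w).
  rewrite /psi /Phi /v /E /= -mulrA -expRD; congr (_ * expR _).
  rewrite /batch_sum big_ord_recr /= -/(batch_sum y m w).
  move: (batch_sum y m w) (g (y w) (U m w) - gradient f (y w)) => S e.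
  by rewrite !dotE (dotC e S); ring.
under eq_integral do rewrite peel.
rewrite freeze.
have ks : kappa * s <= 1 / 2.
  have : 0 <= kappa * (m%:R * s) by rewrite !mulr_ge0 // ltW.
  by move: range; rewrite mulrSr; lra.
pose A' w := A w * expR ((dot (u w) (u w) + 2 * kappa) * s).
pose k' := kappa * (1 + 4 * kappa * s).
pose u' w := (1 + 4 * kappa * s) *: u w.
have mA' : measurable_fun setT A'.
  apply: measurable_funM => //; apply: measurable_expR_comp.
  by apply: measurable_funM => //; apply: measurable_funD => //; exact: measurable_dot.
have mu' : vec_measurable u' by exact: vec_measurableZl.
apply: (@le_trans _ _ (\int[P]_w (A' w * expR (dot (u' w) (batch_sum y m w)
     + k' * dot (batch_sum y m w) (batch_sum y m w)))%:E)%E).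
  have mA'O : measurable_fun (setT : set Omega) (A' : Omega -> R).
    exact: measurable_fun_finer H_measurable mA'.
  have mu'O : @vec_measurable R n _ Omega u'.
    by move=> j; exact: measurable_fun_finer H_measurable (mu' j).
  have mSO : @vec_measurable R n _ Omega (batch_sum y m).
    by move=> j; exact: measurable_fun_finer (prefix_measurable (ltnW mr)) (mS j).
  apply: ge0_le_integral => //.
  - move=> w _; apply: integral_ge0 => c _; rewrite lee_fin; exact: psi0.
  - apply: (measurable_fun_finer (prefix_measurable (ltnW mr))).
    apply: (@measurable_fun_fubini_tonelli_F _ _ _ _ _ mu (EFin \o psi)).
      exact/measurable_EFinP.
    by move=> p; rewrite lee_fin.
  - apply/measurable_EFinP; apply: measurable_funM => //; apply: measurable_expR_comp.
    apply: measurable_funD; first exact: measurable_dot.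
    by apply: measurable_funM => //; exact: measurable_dot.
  - move=> w _; rewrite /psi /=.
    have mX := vec_measurable_oracle_error oracle (y w).
    rewrite integral_scale //; last first.
      apply: measurable_expR_comp; apply: measurable_funD.
        exact: (measurable_dot (vec_measurable_cst (v w)) mX).
      by apply: measurable_funM => //; exact: measurable_dot.
    have mgf := oracle_mgf sigma0 oracle (y w) (v w) k0 ks.
    apply: (le_trans (lee_wpmul2l _ mgf)); first by rewrite lee_fin.
    rewrite -EFinM lee_fin /Phi /A' -[leLHS]mulrA -[leRHS]mulrA -!expRD ler_wpM2l // ler_expR.
    rewrite quadratic_peel addrC /u' /k'; exact: lexx.
have k'0 : 0 <= k' by rewrite mulr_ge0 // addr_ge0 // !mulr_ge0 // ltW.
have A'0 w : 0 <= A' w by rewrite mulr_ge0 ?expR_ge0.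
have range' : 4 * k' * (m%:R * s) < 1 by apply: mgf_budget_range => //; exact: ltW.
apply: le_trans (IH u' A' k' (ltnW mr) my mu' mA' A'0 k'0 range') _.
have mAO : measurable_fun (setT : set Omega) (A : Omega -> R).
  exact: measurable_fun_finer H_measurable mA.
have muO : @vec_measurable R n _ Omega u.
  by move=> j; exact: measurable_fun_finer H_measurable (mu_ j).
have mA'O : measurable_fun (setT : set Omega) (A' : Omega -> R).
  exact: measurable_fun_finer H_measurable mA'.
have mbudget (h : Omega -> R) k : measurable_fun setT h -> forall t,
    measurable_fun setT (fun w => mgf_budget (h w) k t).
  move=> mh t; rewrite /mgf_budget; apply: measurable_funM => //.
  by apply: measurable_funM => //; exact: measurable_funD.
apply: le_integral_ge0.
- apply: measurable_funM => //; apply: measurable_expR_comp; apply: mbudget.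
  by apply: measurable_dot => j; exact: measurable_fun_finer H_measurable (mu' j).
- apply: measurable_funM => //; apply: measurable_expR_comp; apply: mbudget.
  exact: measurable_dot.
- by move=> w; rewrite mulr_ge0 ?expR_ge0.
- move=> w; rewrite /A' -mulrA -expRD ler_wpM2l // ler_expR.
  have := mgf_budget_step (dot_ge0 (u w)) k0 (ltW s0) range.
  by rewrite /u' !dotE mulrA -expr2.
Qed.

(** Averaging [r] samples divides their variance proxy by [r]. *)
Lemma minibatch_mgf (y u S : past -> 'rV[R]_n) (A : past -> R) (kappa : R) :
  (forall w, S w = minibatch g r (y w) (fun i => U i w) - gradient f (y w)) ->
  (0 < r)%N -> vec_measurable y -> vec_measurable u -> measurable_fun setT A ->
  (forall w, 0 <= A w) -> 0 <= kappa -> 4 * kappa * (s / r%:R) < 1 ->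
  (\int[P]_w (A w * expR (dot (u w) (S w) + kappa * dot (S w) (S w)))%:E
   <= \int[P]_w (A w * expR (mgf_budget (dot (u w) (u w)) kappa (s / r%:R)))%:E)%E.
Proof.
move=> SE r0 my mu_ mA A0 k0 range.
have rn : 0 < r%:R :> R by rewrite ltr0n.
have rn0 := lt0r_neq0 rn.
have {}SE w : S w = r%:R^-1 *: batch_sum y r w.
  rewrite SE /minibatch /batch_sum sumrB scalerBr; congr (_ - _).
  by rewrite sumr_const card_ord -(scaler_nat r (gradient f (y w))) scalerA mulVf // scale1r.
have mu' : vec_measurable (fun w => r%:R^-1 *: u w) by exact: vec_measurableZl.
have k'0 : 0 <= kappa / r%:R ^+ 2 by rewrite divr_ge0 ?sqr_ge0.
have range' : 4 * (kappa / r%:R ^+ 2) * (r%:R * s) < 1.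
  by apply: le_lt_trans range; rewrite le_eqVlt; apply/orP; left; apply/eqP; field.
have := batch_sum_mgf (leqnn r) my mu' mA A0 k'0 range'.
under eq_integral => w _.
  have -> : dot (r%:R^-1 *: u w) (batch_sum y r w)
       + kappa / r%:R ^+ 2 * dot (batch_sum y r w) (batch_sum y r w)
     = dot (u w) (S w) + kappa * dot (S w) (S w).
    by rewrite SE !dotE; field.
  over.
move=> /le_trans; apply; rewrite le_eqVlt; apply/orP; left; apply/eqP.
apply: eq_integral => w _; congr (_ * expR _)%:E.
rewrite /mgf_budget !dotE.
have -> : 4 * (kappa / r%:R ^+ 2) * (r%:R * s) = 4 * kappa * (s / r%:R) by field.
by congr (_ / _); field.
Qed.

End Batch.

(** * Categorical quantization *)

Section Categorical.
Context {R : realType} {n : nat}.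
Hypothesis n0 : (0 < n)%N.
Implicit Types v : 'rV[R]_n.

Lemma norm1_ge0 v : 0 <= norm1 v.
Proof. exact: sumr_ge0. Qed.

Lemma pos_part_ge0 v i : 0 <= pos_part v 0 i.
Proof. by rewrite mxE le_max lexx orbT. Qed.

Lemma norm1_pos_part v : norm1 (pos_part v) = \sum_i pos_part v 0 i.
Proof. by apply: eq_bigr => i _; rewrite ger0_norm ?pos_part_ge0. Qed.

Lemma pos_partB v : pos_part v - pos_part (- v) = v.
Proof.
apply/rowP => i; rewrite !mxE; move: (v 0 i) => a.
have [a0|/ltW a0] := leP a 0.
  by rewrite max_l ?oppr_ge0 // sub0r opprK.
by rewrite max_r ?oppr_le0 // subr0.
Qed.

Lemma norm1_split v : norm1 (pos_part v) + norm1 (pos_part (- v)) = norm1 v.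
Proof.
rewrite !norm1_pos_part -big_split; apply: eq_bigr => i _ /=.
rewrite !mxE; move: (v 0 i) => a.
have [a0|a0] := leP a 0.
  by rewrite max_l ?oppr_ge0 // add0r ler0_norm.
by rewrite max_r ?oppr_le0 ?ltW // addr0 gtr0_norm.
Qed.

Lemma categorical_ge0 v i : 0 <= categorical v i.
Proof.
rewrite /categorical; case: ifP => _; first by rewrite invr_ge0.
by rewrite divr_ge0 ?pos_part_ge0 ?norm1_ge0.
Qed.

Lemma categorical_sum v : \sum_i categorical v i = 1.
Proof.
rewrite /categorical; case: eqVneq => v0.
  by rewrite sumr_const card_ord -[LHS]mulr_natr mulVf // pnatr_eq0 -lt0n.
by rewrite -mulr_suml -norm1_pos_part divff.
Qed.

(** Deviation of one scaled sample from the positive part it estimates. *)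
Definition quant_dev v (i : 'I_n) : 'rV[R]_n :=
  norm1 (pos_part v) *: delta_mx 0 i - pos_part v.

Lemma norm1_mul_categorical v i : norm1 (pos_part v) * categorical v i = pos_part v 0 i.
Proof.
rewrite /categorical; case: eqVneq => [v0|v0]; last by rewrite mulrC divfK.
rewrite v0 mul0r; apply/esym/eqP.
move: v0; rewrite norm1_pos_part => /eqP; rewrite psumr_eq0.
  by move=> /allP /(_ i (mem_index_enum _)).
by move=> j _; exact: pos_part_ge0.
Qed.

Lemma quant_dev_mean v : \sum_i categorical v i *: quant_dev v i = 0.
Proof.
under eq_bigr do rewrite /quant_dev scalerBr.
rewrite sumrB -scaler_suml categorical_sum scale1r; apply/eqP; rewrite subr_eq0; apply/eqP.
rewrite [RHS]row_sum_delta; apply: eq_bigr => i _.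
by rewrite scalerA mulrC norm1_mul_categorical.
Qed.

Lemma dot_delta v i : dot (delta_mx 0 i) v = v 0 i.
Proof.
rewrite /dot (bigD1 i) //= mxE !eqxx mul1r big1 ?addr0 // => j ji.
by rewrite mxE (negbTE ji) andbF mul0r.
Qed.

Lemma sqr_pos_part_le v : dot (pos_part v) (pos_part v) <= norm1 (pos_part v) ^+ 2.
Proof.
rewrite expr2 {1}norm1_pos_part mulr_suml; apply: ler_sum => i _.
rewrite ler_wpM2l ?pos_part_ge0 // norm1_pos_part (bigD1 i) //= lerDl sumr_ge0 // => j _.
exact: pos_part_ge0.
Qed.

(** In dimension one the sample is deterministic; in higher dimensions the
    crude bound [2 <= 4 (1 - 1/n)] is enough. *)
Lemma quant_dev_bound v i : dot (quant_dev v i) (quant_dev v i)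
  <= 4 * (1 - n%:R^-1) * norm1 (pos_part v) ^+ 2.
Proof.
have [n1|n1] := ltnP 1 n; last first.
  have en : n = 1%N by apply/eqP; rewrite eqn_leq n1.
  suff -> : quant_dev v i = 0.
    by rewrite dot0l (_ : n%:R = 1 :> R) ?en // invr1 subrr mulr0 mul0r.
  have all_i (j : 'I_n) : j = i.
    by apply: val_inj; case: (j) (i) => [a ?] [b ?] /=; lia.
  apply/rowP => j; rewrite !mxE (all_i j) !eqxx mulr1 norm1_pos_part.
  by rewrite (big_pred1 i) ?mxE ?subrr // => a /=; rewrite (all_i a) eqxx.
have half : n%:R^-1 <= 1 / 2 :> R.
  by rewrite mul1r lef_pV2 ?posrE ?ltr0n // ler_nat.
rewrite /quant_dev !dotE (dotC (pos_part v)) !dot_delta !mxE !eqxx /= mulr1.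
have := sqr_pos_part_le v; have := norm1_ge0 (pos_part v).
have := pos_part_ge0 v i; rewrite mxE.
set a := norm1 _; set p := Num.max _ _; set q := dot _ _ => p0 a0 qa.
have ap := mulr_ge0 a0 p0.
have : 2 * a ^+ 2 <= 4 * (1 - n%:R^-1) * a ^+ 2.
  by rewrite ler_wpM2r ?sqr_ge0 //; lra.
rewrite !expr2 in qa *; lra.
Qed.

Context {d} {T : measurableType d}.

Lemma measurable_categorical (v : T -> 'rV[R]_n) i : vec_measurable v ->
  measurable_fun setT (fun w => categorical (v w) i).
Proof.
move=> mv; have mp := vec_measurable_pos_part mv.
apply: measurable_fun_ifT.
- by apply: measurable_fun_eqr => //; exact: measurable_norm1.
- exact: measurable_cst.
- apply: measurable_funM; first exact: mp.
  (* on nonnegative reals the inverse is the power function of exponent -1 *)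
  have -> : (fun w => (norm1 (pos_part (v w)))^-1) =
      (@powR R ^~ (-1)) \o (fun w => norm1 (pos_part (v w))).
    by apply/funext => w /=; rewrite powR_inv1 // norm1_ge0.
  by apply: measurableT_comp; [exact: measurable_powR|exact: measurable_norm1].
Qed.

End Categorical.

Section Quantization.
Context {R : realType} {n : nat}.
Hypothesis n0 : (0 < n)%N.
Variables (M : nat) (B : R).
Hypothesis M0 : (0 < M)%N.
Hypothesis B0 : 0 <= B.
Implicit Types v : 'rV[R]_n.

(** The [j]-th draws of the two index sequences are treated as one draw of a
    pair, which makes the quantization error a sum of [M] i.i.d. vectors. *)
Definition pair_law v (c : 'I_n * 'I_n) : R := categorical v c.1 * categorical (- v) c.2.

Definition pair_dev v (c : 'I_n * 'I_n) : 'rV[R]_n :=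
  M%:R^-1 *: (quant_dev v c.1 - quant_dev (- v) c.2).

Lemma pair_law_ge0 v c : 0 <= pair_law v c.
Proof. by rewrite mulr_ge0 ?categorical_ge0. Qed.

Lemma pair_law_sum v : \sum_c pair_law v c = 1.
Proof.
rewrite -(pair_bigA _ (fun i j => categorical v i * categorical (- v) j)) /=.
under eq_bigr do rewrite -mulr_sumr categorical_sum // mulr1.
exact: categorical_sum.
Qed.

Lemma pair_dev_mean v : \sum_c pair_law v c *: pair_dev v c = 0.
Proof.
rewrite -(pair_bigA _ (fun i j => pair_law v (i, j) *: pair_dev v (i, j))) /=.
have E i j : pair_law v (i, j) *: pair_dev v (i, j) =
   M%:R^-1 *: (categorical (- v) j *: (categorical v i *: quant_dev v i)
     - categorical v i *: (categorical (- v) j *: quant_dev (- v) j)).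
  rewrite /pair_law /pair_dev /=; move: (quant_dev v i) (quant_dev (- v) j) => p q.
  by apply/rowP => m; rewrite !mxE; ring.
under eq_bigr do under eq_bigr do rewrite E.
under eq_bigr => i _.
  rewrite -scaler_sumr sumrB -scaler_suml -scaler_sumr !categorical_sum //.
  rewrite quant_dev_mean // scaler0 subr0 scale1r.
  over.
by rewrite -scaler_sumr quant_dev_mean // scaler0.
Qed.

(** The two one-norms add up to the one-norm of [v]
    ([norm1_split]), hence the bound by [B] with no loss from the pairing. *)
Lemma pair_dev_bound v c : norm1 v <= B ->
  dot (pair_dev v c) (pair_dev v c) <= 4 * (1 - n%:R^-1) * B ^+ 2 / M%:R ^+ 2.
Proof.
move=> vB; rewrite /pair_dev.
have := quant_dev_bound n0 v c.1; have := quant_dev_bound n0 (- v) c.2.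
have := norm1_split v; have := norm1_ge0 (pos_part v); have := norm1_ge0 (pos_part (- v)).
have C0 : 0 <= 4 * (1 - n%:R^-1) :> R.
  by rewrite mulr_ge0 // subr_ge0 invf_le1 ?ltr0n // ler1n.
move: (quant_dev v c.1) (quant_dev (- v) c.2) => p q.
set a := norm1 (pos_part v); set b := norm1 (pos_part (- v)).
move: (4 * (1 - n%:R^-1)) C0 => C C0 b0 a0 ab hq hp.
have cross : `|dot p q| <= C * (a * b).
  have Cab : 0 <= C * (a * b) by rewrite !mulr_ge0.
  rewrite -(@ler_pXn2r _ 2) ?nnegrE // real_normK ?num_real //.
  apply: le_trans (sqr_dot_le _ _) _.
  have -> : (C * (a * b)) ^+ 2 = (C * a ^+ 2) * (C * b ^+ 2) by ring.
  by apply: ler_pM => //; exact: dot_ge0.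
have : dot (p - q) (p - q) <= C * B ^+ 2.
  have h1 : C * (a + b) ^+ 2 <= C * B ^+ 2.
    rewrite ler_wpM2l // ab; apply: lerXn2r; rewrite ?nnegrE ?norm1_ge0 //.
  apply: le_trans h1; rewrite !dotE (dotC q p).
  move: cross; rewrite ler_norml => /andP[c1 c2].
  rewrite sqrrD mulrDr mulrDr -mulr_natr; lra.
move=> h; rewrite dotZl dotZr mulrA -expr2 exprVn [leLHS]mulrC.
by rewrite ler_wpM2r // invr_ge0 sqr_ge0.
Qed.

Lemma PPS_dev dX (Xi : measurableType dX) (g : 'rV[R]_n -> Xi -> 'rV[R]_n) r x (xi : nat -> Xi)
    (k l : nat -> 'I_n) :
  PPS g r M x xi k l - minibatch g r x xi
  = \sum_(j < M) pair_dev (minibatch g r x xi) (k j, l j).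
Proof.
rewrite /PPS /pair_dev; move: (minibatch g r x xi) => v.
have Mn : M%:R != 0 :> R by rewrite pnatr_eq0 -lt0n.
rewrite -scaler_sumr /quant_dev /= !sumrB !sumr_const card_ord -!scaler_sumr.
rewrite -(scaler_nat M (pos_part v)) -(scaler_nat M (pos_part (- v))).
rewrite -[X in _ - X = _](pos_partB v).
move: (\sum_(j < M) delta_mx 0 (k j)) (\sum_(j < M) delta_mx 0 (l j)) => D E.
move: (norm1 (pos_part v)) (norm1 (pos_part (- v))) => a b.
move: (pos_part v) (pos_part (- v)) => p q.
by apply/rowP => i; rewrite !mxE; field.
Qed.

Lemma minibatch_norm1 dX (Xi : measurableType dX) (g : 'rV[R]_n -> Xi -> 'rV[R]_n) r x (xi : nat -> Xi) :
  (0 < r)%N -> (forall u, norm1 (g x u) <= B) -> norm1 (minibatch g r x xi) <= B.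
Proof.
move=> r0 gB; rewrite /minibatch /norm1.
have rn : 0 < r%:R :> R by rewrite ltr0n.
under eq_bigr do rewrite mxE normrM gtr0_norm ?invr_gt0 // summxE.
rewrite -mulr_sumr mulrC ler_pdivrMr // mulr_natr.
apply: (@le_trans _ _ (\sum_(i < n) \sum_(j < r) `|g x (xi j) 0 i|)).
  by apply: ler_sum => i _; exact: ler_norm_sum.
have -> : B *+ r = \sum_(j < r) B by rewrite sumr_const card_ord.
rewrite exchange_big /=.
by apply: ler_sum => j _; exact: gB.
Qed.

Context {d} {Omega : measurableType d} (P : probability Omega R).
Variables (H : set (set Omega)) (k l : nat -> Omega -> 'I_n).
Hypothesis H_measurable : H `<=` @measurable _ Omega.
Hypothesis quant_measurable : forall j, (j < M)%N -> forall a : 'I_n,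
  measurable (k j @^-1` [set a]) /\ measurable (l j @^-1` [set a]).
Let past := g_sigma_algebraType H.
Variable G : past -> 'rV[R]_n.
Hypothesis mG : vec_measurable G.
Hypothesis GB : forall w, norm1 (G w) <= B.
Hypothesis law : forall (E : set Omega) (a b : nat -> 'I_n), <<s H >> E ->
  (P (E `&` [set w | forall j, (j < M)%N -> k j w = a j /\ l j w = b j])
   = \int[P]_(w in E) ((\prod_(j < M) categorical (G w) (a j)) *
          (\prod_(j < M) categorical (- G w) (b j)))%:E)%E.

Let drawn (c : M.-tuple ('I_n * 'I_n)) : set Omega :=
  [set w | forall j : 'I_M, k j w = (tnth c j).1 /\ l j w = (tnth c j).2].

Let drawn_measurable c : measurable (drawn c).
Proof.
have -> : drawn c = \bigcap_(j in [set: 'I_M])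
   ((k j @^-1` [set (tnth c j).1]) `&` (l j @^-1` [set (tnth c j).2])).
  by apply/seteqP; split=> w /= h j; [move=> _|]; exact: h.
apply: fin_bigcap_measurable; first exact: finite_finset.
move=> j _; apply: measurableI; first by have [] := quant_measurable (ltn_ord j) (tnth c j).1.
by have [] := quant_measurable (ltn_ord j) (tnth c j).2.
Qed.

Let weight c (w : Omega) : R := \prod_(j < M) pair_law (G w) (tnth c j).

Let weight_measurable c : measurable_fun (setT : set Omega) (weight c).
Proof.
apply: (measurable_fun_finer (G := H)) => //.
apply: measurable_prod => j _; rewrite /pair_law; apply: measurable_funM; apply: measurable_categorical => //.
exact: vec_measurableN.
Qed.

Let drawn_law c E : <<s H >> E ->
  (\int[P]_(w in E) (\1_(drawn c) w)%:E = \int[P]_(w in E) (weight c w)%:E)%E.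
Proof.
move=> HE.
have mE : measurable E.
  by move: HE; apply: smallest_sub => //; exact: sigma_algebra_measurable.
rewrite integral_indic //.
pose c0 : 'I_n * 'I_n := (Ordinal n0, Ordinal n0).
have -> : drawn c `&` E =
   E `&` [set w | forall j, (j < M)%N -> k j w = (nth c0 c j).1 /\ l j w = (nth c0 c j).2].
  rewrite setIC; congr (_ `&` _); apply/seteqP; split=> w /= h j.
    by move=> jM; have := h (Ordinal jM); rewrite (tnth_nth c0).
  by have := h j (ltn_ord j); rewrite (tnth_nth c0).
have /= -> := @law E (fun j => (nth c0 c j).1) (fun j => (nth c0 c j).2) HE.
apply: eq_integral => w _; rewrite /weight -big_split; congr EFin.
by apply: eq_bigr => j _; rewrite /pair_law (tnth_nth c0).
Qed.

(** Given the batch, the law of the draws is known on events of the past only;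
    [integral_density] extends it to functions of the past, outcome by outcome,
    and the finite sum over outcomes is bounded by [discrete_sum_mgf]. *)
Lemma quantization_mgf (u : past -> 'rV[R]_n) (A : past -> R)
    (Q : Omega -> 'rV[R]_n) (kappa : R) :
  (forall w, Q w = \sum_(j < M) pair_dev (G w) (k j w, l j w)) ->
  vec_measurable u -> measurable_fun setT A -> (forall w, 0 <= A w) -> 0 <= kappa ->
  let v := 4 * (1 - n%:R^-1) * B ^+ 2 / M%:R in
  4 * kappa * v < 1 ->
  (\int[P]_w (A w * expR (dot (u w) (Q w) + kappa * dot (Q w) (Q w)))%:E
   <= \int[P]_w (A w * expR (mgf_budget (dot (u w) (u w)) kappa v))%:E)%E.
Proof.
move=> QE mu_ mA A0 k0 v range.
pose dev c w := \sum_(j < M) pair_dev (G w) (tnth c j).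
pose F c (w : past) := A w * expR (dot (u w) (dev c w) + kappa * dot (dev c w) (dev c w)).
have mdev c : vec_measurable (dev c : past -> _).
  apply: vec_measurable_sum => j; apply: vec_measurableZl.
  have mq (h : past -> 'rV[R]_n) i : vec_measurable h ->
      vec_measurable (fun w => quant_dev (h w) i).
    move=> mh; apply: vec_measurableB; last exact: vec_measurable_pos_part.
    apply: vec_measurableZ; last exact: vec_measurable_cst.
    by apply: measurable_norm1; exact: vec_measurable_pos_part.
  by apply: vec_measurableB; apply: mq => //; exact: vec_measurableN.
have mF c : measurable_fun setT (F c).
  apply: measurable_funM => //; apply: measurable_expR_comp; apply: measurable_funD.
    exact: measurable_dot.
  by apply: measurable_funM => //; exact: measurable_dot.
have F0 c w : 0 <= F c w by rewrite mulr_ge0 ?expR_ge0.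
have mFO c : measurable_fun (setT : set Omega) (F c : Omega -> R).
  exact: (measurable_fun_finer (G := H)).
have weight0 c w : 0 <= weight c w by apply: prodr_ge0 => j _; exact: pair_law_ge0.
have m1 c : measurable_fun (setT : set Omega) (\1_(drawn c) : Omega -> R).
  exact: measurable_indic.
(* exactly one outcome of the draws is realised *)
have split w : A w * expR (dot (u w) (Q w) + kappa * dot (Q w) (Q w))
    = \sum_c F c w * \1_(drawn c) w.
  pose c0 := [tuple (k j w, l j w) | j < M].
  have other : \sum_(c | c != c0) F c w * \1_(drawn c) w = 0.
    apply: big1 => c cn; rewrite indicE memNset ?mulr0 // => dw; move/eqP: cn; apply.
    apply: eq_from_tnth => j; rewrite tnth_mktuple.
    by have [-> ->] := dw j; case: (tnth c j).
  rewrite (bigD1 c0) //= other addr0 indicE mem_set; last by move=> j; rewrite tnth_mktuple.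
  rewrite mulr1 /F; suff -> : Q w = dev c0 w by [].
  by rewrite QE; apply: eq_bigr => j _; rewrite tnth_mktuple.
under eq_integral do rewrite split -sumEFin.
rewrite ge0_integral_sum //; last 2 first.
- by move=> c; apply/measurable_EFinP; exact: measurable_funM.
- by move=> c w _; rewrite lee_fin mulr_ge0.
have swap c : (\int[P]_w (F c w * \1_(drawn c) w)%:E = \int[P]_w (F c w * weight c w)%:E)%E.
  apply: (integral_density (G := H)) => //.
    exact: drawn_law.
under eq_bigr do rewrite swap.
rewrite -ge0_integral_sum //; last 2 first.
- by move=> c; apply/measurable_EFinP; exact: measurable_funM.
- by move=> c w _; rewrite lee_fin mulr_ge0.
under eq_integral do rewrite sumEFin.
have mAO : measurable_fun (setT : set Omega) (A : Omega -> R).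
  exact: (measurable_fun_finer (G := H)).
have muO : @vec_measurable R n _ Omega u.
  by move=> j; exact: (measurable_fun_finer (G := H)).
apply: le_integral_ge0.
- by apply: measurable_sum => c; exact: measurable_funM.
- apply: measurable_funM => //; apply: measurable_expR_comp.
  rewrite /mgf_budget; apply: measurable_funM => //; apply: measurable_funM => //.
  by apply: measurable_funD => //; exact: measurable_dot.
- by move=> w; apply: sumr_ge0 => c _; rewrite mulr_ge0.
move=> w; under eq_bigr do rewrite /F -mulrA.
rewrite -mulr_sumr ler_wpM2l //.
have C0 : 0 <= 4 * (1 - n%:R^-1) :> R.
  by rewrite mulr_ge0 // subr_ge0 invf_le1 ?ltr0n // ler1n.
have rho0 : 0 <= 4 * (1 - n%:R^-1) * B ^+ 2 / M%:R ^+ 2.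
  by rewrite divr_ge0 ?sqr_ge0 // mulr_ge0 ?sqr_ge0.
have vE : v = M%:R * (4 * (1 - n%:R^-1) * B ^+ 2 / M%:R ^+ 2).
  rewrite /v; field; rewrite !pnatr_eq0 -!lt0n M0 n0 //.
rewrite vE in range *.
have := discrete_sum_mgf (pair_law_ge0 (G w)) (pair_law_sum (G w)) (pair_dev_mean (G w))
  (fun c => pair_dev_bound c (GB w)) (u w) k0 rho0 range.
apply: le_trans; rewrite le_eqVlt; apply/orP; left; apply/eqP.
by apply: eq_bigr => c _; rewrite mulrC.
Qed.

End Quantization.

(** * The sampling filtration and the iterates *)

Section Sampling.
Context {R : realType} {n : nat}.
Context {d} {Omega : measurableType d} {dX} {Xi : measurableType dX}.
Variables (r M : nat -> nat).
Variables (xi : nat -> nat -> Omega -> Xi) (k l : nat -> nat -> Omega -> 'I_n).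

(** Generators of the sigma-algebra [history], kept apart from it so that the
    past can be equipped with its own measurable structure. *)
Definition sampling_events (tb tq : nat) : set (set Omega) :=
  [set E | (exists s i (C : set Xi), [/\ (s < tb)%N, (i < r s)%N,
                  measurable C & E = xi s i @^-1` C]) \/
               (exists s j (a : 'I_n), [/\ (s < tq)%N, (j < M s)%N &
                  E = k s j @^-1` [set a] \/ E = l s j @^-1` [set a]])].

Definition past tb tq := g_sigma_algebraType (sampling_events tb tq).

Lemma sampling_events_mono tb tq tb' tq' : (tb <= tb')%N -> (tq <= tq')%N ->
  sampling_events tb tq `<=` sampling_events tb' tq'.
Proof.
move=> b q E [[s [i [C [sb ir mC ->]]]]|[s [j [a [sq jM eE]]]]].
  by left; exists s, i, C; split=> //; exact: leq_trans b.
by right; exists s, j, a; split=> //; exact: leq_trans q.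
Qed.

Lemma vec_measurable_past tb tq tb' tq' (v : Omega -> 'rV[R]_n) :
  (tb <= tb')%N -> (tq <= tq')%N ->
  @vec_measurable R n _ (past tb tq) v -> @vec_measurable R n _ (past tb' tq') v.
Proof.
move=> b q mv i; apply: measurable_fun_generator (mv i) => A HA.
by apply: sub_sigma_algebra; exact: sampling_events_mono HA.
Qed.

Lemma measurable_sample tb tq t i : (t < tb)%N -> (i < r t)%N ->
  measurable_fun (setT : set (past tb tq)) (xi t i).
Proof.
move=> tb_ ir _ C mC; rewrite setTI; apply: sub_sigma_algebra.
by left; exists t, i, C.
Qed.

Lemma vec_measurable_draw (h : Omega -> 'I_n) tb tq :
  (forall a, <<s sampling_events tb tq >> (h @^-1` [set a])) ->
  @vec_measurable R n _ (past tb tq) (fun w => delta_mx 0 (h w)).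
Proof.
move=> hE i.
have -> : (fun w => (delta_mx 0 (h w) : 'rV[R]_n) 0 i) = \1_(h @^-1` [set i]).
  apply/funext => w; rewrite mxE eqxx /= indicE; congr (nat_of_bool _)%:R.
  by apply/eqP/idP => [->|]; [rewrite mem_set|rewrite inE /= => ->].
exact: (@measurable_indic _ (past tb tq) R setT _ (hE i)).
Qed.

Lemma vec_measurable_draws tb tq t j : (t < tq)%N -> (j < M t)%N ->
  @vec_measurable R n _ (past tb tq) (fun w => delta_mx 0 (k t j w)) /\
  @vec_measurable R n _ (past tb tq) (fun w => delta_mx 0 (l t j w)).
Proof.
move=> tq_ jM; split; apply: vec_measurable_draw => a; apply: sub_sigma_algebra;
  right; exists t, j, a; split=> //; [by left|by right].
Qed.

Variables (P : probability Omega R) (mu : probability Xi R).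
Variables (g : 'rV[R]_n -> Xi -> 'rV[R]_n) (T : nat) (y : nat -> Omega -> 'rV[R]_n).
Hypothesis fresh : fresh_sampling P mu g T r M xi k l y.

Lemma sampling_events_measurable tb tq : (tb <= T.+1)%N -> (tq <= T.+1)%N ->
  sampling_events tb tq `<=` @measurable _ Omega.
Proof.
move=> b q E [[s [i [C [sb ir mC ->]]]]|[s [j [a [sq jM eE]]]]].
  rewrite -[X in measurable X]setTI; apply: (batch_measurable fresh) => //.
  by rewrite -ltnS; exact: leq_trans b.
have [] := quant_measurable fresh (leq_trans sq q : (s <= T)%N) jM a.
by case: eE => ->.
Qed.

Variables (f : 'rV[R]_n -> R) (sigma B : R).
Hypothesis oracle : stochastic_oracle mu g f sigma B.

Lemma vec_measurable_minibatch tb tq t (v : Omega -> 'rV[R]_n) : (t < tb)%N ->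
  @vec_measurable R n _ (past tb tq) v ->
  @vec_measurable R n _ (past tb tq) (fun w => minibatch g (r t) (v w) (fun i => xi t i w)).
Proof.
move=> tb_ mv; apply: vec_measurableZl; apply: vec_measurable_sum => i.
by apply: (vec_measurable_oracle oracle) => //; exact: measurable_sample.
Qed.

Lemma vec_measurable_PPS tb tq t (v : Omega -> 'rV[R]_n) : (t < tb)%N -> (t < tq)%N ->
  @vec_measurable R n _ (past tb tq) v ->
  @vec_measurable R n _ (past tb tq) (fun w => PPS g (r t) (M t) (v w)
     (fun i => xi t i w) (fun j => k t j w) (fun j => l t j w)).
Proof.
move=> b q mv; have mb := vec_measurable_minibatch b mv.
have scaled (h : past tb tq -> 'rV[R]_n) (D : nat -> past tb tq -> 'rV[R]_n) :
    vec_measurable h -> (forall j, (j < M t)%N -> vec_measurable (D j)) ->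
    vec_measurable (fun w => (norm1 (pos_part (h w)) / (M t)%:R) *: \sum_(j < M t) D j w).
  move=> mh mD; apply: vec_measurableZ.
    by apply: measurable_funM => //; apply: measurable_norm1; exact: vec_measurable_pos_part.
  by apply: vec_measurable_sum => j; exact: mD.
apply: vec_measurableB.
- apply: (scaled _ (fun j w => delta_mx 0 (k t j w))) => // j jM.
  by have [] := vec_measurable_draws tb q jM.
- apply: (scaled _ (fun j w => delta_mx 0 (l t j w))) => [|j jM].
    exact: vec_measurableN.
  by have [] := vec_measurable_draws tb q jM.
Qed.

Variables (L : R) (alpha beta : nat -> R) (x z yhat G : nat -> Omega -> 'rV[R]_n).
Hypothesis method : forall w : Omega, primal_method T alpha beta
  (fun t v => PPS g (r t) (M t) v
     (fun i => xi t i w) (fun j => k t j w) (fun j => l t j w))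
  (fun t => x t w) (fun t => y t w) (fun t => z t w)
  (fun t => yhat t w) (fun t => G t w).

(** Before iteration [t] everything the method has computed, including the next
    query point, depends on the samples of the iterations before [t] only. *)
Lemma iterates_measurable t : (t <= T.+1)%N ->
  (forall s, (s < t)%N -> [/\ @vec_measurable R n _ (past t t) (G s),
      @vec_measurable R n _ (past t t) (x s) & @vec_measurable R n _ (past t t) (y s)]) /\
  ((t <= T)%N -> @vec_measurable R n _ (past t t) (y t)).
Proof.
elim: t => [|t IH] tT.
  split=> // _; rewrite (_ : y 0%N = fun=> 0); first exact: vec_measurable_cst.
  by apply/funext => w; exact: primal_y0 (method w).
have [before yt] := IH (ltnW tT).
have mono := @vec_measurable_past t t t.+1 t.+1 _ (leqnSn t) (leqnSn t).
have {}yt : @vec_measurable R n _ (past t.+1 t.+1) (y t) by apply: mono; exact: yt.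
have Gt : @vec_measurable R n _ (past t.+1 t.+1) (G t).
  rewrite (_ : G t = fun w => PPS g (r t) (M t) (y t w)
     (fun i => xi t i w) (fun j => k t j w) (fun j => l t j w)).
    exact: vec_measurable_PPS.
  by apply/funext => w; exact: primal_G (method w) t tT.
have Gs s : (s <= t)%N -> @vec_measurable R n _ (past t.+1 t.+1) (G s).
  rewrite leq_eqVlt => /predU1P[->//|st].
  by have [mG _ _] := before s st; exact: mono.
have zs s : (s < T)%N -> (s <= t)%N -> @vec_measurable R n _ (past t.+1 t.+1) (z s).
  move=> sT st; rewrite (_ : z s = fun w => - (beta s)^-1 *: \sum_(i < s.+1) alpha i *: G i w).
    apply: vec_measurableZl; apply: vec_measurable_sum => i; apply: vec_measurableZl.
    by apply: Gs; apply: leq_trans st; rewrite -ltnS.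
  by apply/funext => w; exact: primal_z (method w) s sT.
have xt : @vec_measurable R n _ (past t.+1 t.+1) (x t).
  case: t tT before {IH} yt mono Gt Gs zs => [|s] sT before yt mono Gt Gs zs.
    rewrite (_ : x 0%N = fun w => - (alpha 0%N / beta 0%N) *: G 0%N w).
      exact: vec_measurableZl.
    by apply/funext => w; exact: primal_x0 (method w).
  have [_ xs _] := before s (ltnSn s).
  rewrite (_ : x s.+1 = fun w => tau alpha s *: (z s w - (alpha s.+1 / beta s) *: G s.+1 w)
     + (1 - tau alpha s) *: x s w).
    apply: vec_measurableD; apply: vec_measurableZl; last exact: mono.
    by apply: vec_measurableB; [exact: zs|exact: vec_measurableZl].
  by apply/funext => w; rewrite (primal_x (method w) sT) (primal_yhat (method w) sT).
split.
  move=> s; rewrite ltnS leq_eqVlt => /predU1P[->//|st].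
  by have [mG mx my] := before s st; split; exact: mono.
move=> tT'; rewrite (_ : y t.+1 = fun w => tau alpha t *: z t w + (1 - tau alpha t) *: x t w).
  by apply: vec_measurableD; apply: vec_measurableZl => //; exact: zs.
by apply/funext => w; exact: primal_y (method w) t tT'.
Qed.

End Sampling.

(** * Exponential moments of one oracle call *)

Section BudgetConstants.
Context {R : realType}.

(** With [sQ] and [sS] the variance proxies of the quantization and of the
    minibatch, the two budgets add up to a fifth, resp. a half, of the combined
    proxy [v]. The weights 6/5 and 6 are Young's for the square of the sum. *)
Lemma budget_sum (a kappa sQ sS v : R) : 0 <= a -> 0 <= kappa -> 0 <= sQ -> 0 <= sS ->
  50 * sS + 100 / 11 * sQ <= v -> kappa * v <= 5 / 6 ->
  [/\ 4 * (6 / 5 * kappa) * sQ < 1, 4 * (6 * kappa) * sS < 1 &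
     mgf_budget a (6 / 5 * kappa) sQ + mgf_budget a (6 * kappa) sS
       <= v / 5 * a + kappa * v / 2].
Proof.
move=> a0 k0 q0 p0 hv kv.
have kq := mulr_ge0 k0 q0; have kp := mulr_ge0 k0 p0.
have h : 50 * (kappa * sS) + 100 / 11 * (kappa * sQ) <= 5 / 6.
  by have := ler_wpM2l k0 hv; lra.
have dQ : 14 / 25 <= 1 - 4 * (6 / 5 * kappa) * sQ by lra.
have dS : 3 / 5 <= 1 - 4 * (6 * kappa) * sS by lra.
split; [lra|lra|].
have div (b c D : R) : 0 <= b -> 0 < c -> c <= D -> b / D <= b / c.
  by move=> b0 c0 cD; rewrite ler_wpM2l // lef_pV2 ?posrE // (lt_le_trans c0).
apply: (@le_trans _ _ ((a + 2 * (6 / 5 * kappa)) * sQ / (14 / 25)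
                     + (a + 2 * (6 * kappa)) * sS / (3 / 5))).
  apply: lerD; apply: div => //; try lra.
    by rewrite mulr_ge0 // addr_ge0 // !mulr_ge0 //; lra.
  by rewrite mulr_ge0 // addr_ge0 // !mulr_ge0.
have aq := mulr_ge0 a0 q0; have ap := mulr_ge0 a0 p0.
have av := ler_wpM2l a0 hv.
have kv' := ler_wpM2l k0 hv.
have -> : (a + 2 * (6 / 5 * kappa)) * sQ / (14 / 25) = 25 / 14 * (a * sQ) + 30 / 7 * (kappa * sQ) by field.
have -> : (a + 2 * (6 * kappa)) * sS / (3 / 5) = 5 / 3 * (a * sS) + 20 * (kappa * sS) by field.
lra.
Qed.

End BudgetConstants.

Section OracleCall.
Context {R : realType} {n : nat}.
Hypothesis n0 : (0 < n)%N.
Context {d} {Omega : measurableType d} {dX} {Xi : measurableType dX}.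
Variables (r M : nat -> nat).
Variables (xi : nat -> nat -> Omega -> Xi) (k l : nat -> nat -> Omega -> 'I_n).
Variables (P : probability Omega R) (mu : probability Xi R).
Variables (g : 'rV[R]_n -> Xi -> 'rV[R]_n) (T : nat) (y : nat -> Omega -> 'rV[R]_n).
Hypothesis fresh : fresh_sampling P mu g T r M xi k l y.
Variables (f : 'rV[R]_n -> R) (sigma B : R).
Hypothesis sigma0 : 0 < sigma.
Hypothesis oracle : stochastic_oracle mu g f sigma B.

Lemma oracle_bound_ge0 : 0 <= B.
Proof. exact: le_trans (norm1_ge0 _) (oracle_bounded oracle 0 point). Qed.

(** The factor 100 / 11 is 50 times 2 / (4 e) at the upper bound 11 / 4 for
    [e]. *)
Lemma sigma2_split (r' M' : nat) : (0 < r')%N -> (0 < M')%N ->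
  50 * (sigma ^+ 2 / r'%:R) + 100 / 11 * (4 * (1 - n%:R^-1) * B ^+ 2 / M'%:R)
    <= sigma2 n B sigma r' M' :> R.
Proof.
move=> r0 M0; rewrite /sigma2.
have e0 := expR_gt0 (1 : R).
have Mn : 0 < M'%:R :> R by rewrite ltr0n.
have C0 : 0 <= (1 - n%:R^-1) * B ^+ 2 / M'%:R :> R.
  by rewrite divr_ge0 // mulr_ge0 ?sqr_ge0 // subr_ge0 invf_le1 ?ltr0n // ler1n.
have h : 4 / 11 <= (expR 1)^-1 :> R.
  by rewrite -[4 / 11]invrK lef_pV2 ?posrE ?invr_gt0 //; have := @expR1_lt_11div4 R; lra.
have -> : 2 * (1 - n%:R^-1) * B ^+ 2 / (expR 1 * M'%:R)
   = 2 * (expR 1)^-1 * ((1 - n%:R^-1) * B ^+ 2 / M'%:R).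
  by field; rewrite !lt0r_neq0 // ltr0n.
have -> : 4 * (1 - n%:R^-1) * B ^+ 2 / M'%:R = 4 * ((1 - n%:R^-1) * B ^+ 2 / M'%:R) by rewrite !mulrA.
by have := ler_wpM2r C0 h; lra.
Qed.

Variable t : nat.
Hypothesis tT : (t <= T)%N.
Hypotheses (rt0 : (0 < r t)%N) (Mt0 : (0 < M t)%N).
Let now := past r M xi k l t t.
Hypothesis my : @vec_measurable R n _ now (y t).
Let v := sigma2 n B sigma (r t) (M t).

(** The two sources of randomness are averaged out in the reverse of the order
    in which they are drawn. *)
Lemma oracle_call_mgf (u e : now -> 'rV[R]_n) (A : now -> R) (kappa : R) :
  (forall w, e w = PPS g (r t) (M t) (y t w) (fun i => xi t i w)
      (fun j => k t j w) (fun j => l t j w) - gradient f (y t w)) ->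
  vec_measurable u -> measurable_fun setT A -> (forall w, 0 <= A w) ->
  0 <= kappa -> kappa * v <= 5 / 6 ->
  (\int[P]_w (A w * expR (dot (u w) (e w) + kappa * dot (e w) (e w)))%:E
   <= \int[P]_w (A w * expR (v / 5 * dot (u w) (u w) + kappa * v / 2))%:E)%E.
Proof.
move=> eE mu_ mA A0 k0 kv.
pose mb (w : Omega) := minibatch g (r t) (y t w) (fun i => xi t i w).
pose S w := mb w - gradient f (y t w).
pose Q w := \sum_(j < M t) pair_dev (M t) (mb w) (k t j w, l t j w).
have {}eE w : e w = Q w + S w.
  rewrite eE /Q -(PPS_dev Mt0 _ _ _ _ (fun j => k t j w) (fun j => l t j w)).
  by rewrite /S addrA subrK.
have B0 := oracle_bound_ge0.
pose sQ : R := 4 * (1 - n%:R^-1) * B ^+ 2 / (M t)%:R.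
pose sS : R := sigma ^+ 2 / (r t)%:R.
have sS0 : 0 <= sS by rewrite divr_ge0 ?sqr_ge0.
have sQ0 : 0 <= sQ.
  by rewrite divr_ge0 // mulr_ge0 ?sqr_ge0 // mulr_ge0 // subr_ge0 invf_le1 ?ltr0n // ler1n.
have split_v : 50 * sS + 100 / 11 * sQ <= v by exact: sigma2_split.
have rangeQ : 4 * (6 / 5 * kappa) * sQ < 1.
  by have [] := budget_sum (lexx 0) k0 sQ0 sS0 split_v kv.
have rangeS : 4 * (6 * kappa) * sS < 1.
  by have [] := budget_sum (lexx 0) k0 sQ0 sS0 split_v kv.
pose next := past r M xi k l t.+1 t.
have nowM : sampling_events r M xi k l t t `<=` @measurable _ Omega.
  by apply: (sampling_events_measurable fresh); rewrite ltnW // ltnS.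
have nextM : sampling_events r M xi k l t.+1 t `<=` @measurable _ Omega.
  by apply: (sampling_events_measurable fresh) => //; rewrite ltnW.
have now_next (h : Omega -> 'rV[R]_n) : @vec_measurable R n _ now h -> @vec_measurable R n _ next h.
  exact: vec_measurable_past.
have now_next1 (h : Omega -> R) : measurable_fun setT (h : now -> R) -> measurable_fun setT (h : next -> R).
  apply: measurable_fun_generator => E HE; apply: sub_sigma_algebra.
  exact: sampling_events_mono HE.
have mmb : @vec_measurable R n _ next mb.
  by apply: (vec_measurable_minibatch oracle) => //; exact: now_next.
have mgrad : @vec_measurable R n _ next (fun w => gradient f (y t w)).
  by apply: (vec_measurable_gradient oracle); exact: now_next.
have mS : @vec_measurable R n _ next S by exact: vec_measurableB.
have muN : @vec_measurable R n _ next u by exact: now_next.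
have mAN : measurable_fun setT (A : next -> R) by exact: now_next1.
pose A1 w := A w * expR (dot (u w) (S w) + 6 * kappa * dot (S w) (S w)).
have mA1 : measurable_fun setT (A1 : next -> R).
  apply: measurable_funM => //; apply: measurable_expR_comp; apply: measurable_funD.
    exact: measurable_dot.
  by apply: measurable_funM => //; exact: measurable_dot.
have A10 w : 0 <= A1 w by rewrite mulr_ge0 ?expR_ge0.
pose A2 w := A w * expR (mgf_budget (dot (u w) (u w)) (6 / 5 * kappa) sQ).
have mbudget (D : Omega -> R) kk s' : measurable_fun setT (D : now -> R) ->
    measurable_fun setT (fun w : now => mgf_budget (D w) kk s').
  move=> mD; rewrite /mgf_budget; apply: measurable_funM => //.
  by apply: measurable_funM => //; exact: measurable_funD.
have muu : measurable_fun setT (fun w : now => dot (u w) (u w)) by exact: measurable_dot.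
have mA2 : measurable_fun setT (A2 : now -> R).
  by apply: measurable_funM => //; apply: measurable_expR_comp; exact: mbudget.
have A20 w : 0 <= A2 w by rewrite mulr_ge0 ?expR_ge0.
have Omega_next (h : Omega -> R) : measurable_fun setT (h : next -> R) ->
    measurable_fun (setT : set Omega) h.
  exact: measurable_fun_finer.
have Omega_nextv (h : Omega -> 'rV[R]_n) : @vec_measurable R n _ next h ->
    @vec_measurable R n _ Omega h.
  by move=> mh i; exact: measurable_fun_finer nextM (mh i).
have mQ : @vec_measurable R n _ Omega Q.
  have mPPS : @vec_measurable R n _ Omega (fun w => PPS g (r t) (M t) (y t w) (fun i => xi t i w)
      (fun j => k t j w) (fun j => l t j w)).
    have after : @vec_measurable R n _ (past r M xi k l t.+1 t.+1) (y t) by exact: vec_measurable_past my.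
    move=> i; have := vec_measurable_PPS oracle (ltnSn t) (ltnSn t) after i.
    by apply: measurable_fun_finer; exact: (sampling_events_measurable fresh).
  have -> : Q = fun w => PPS g (r t) (M t) (y t w) (fun i => xi t i w)
      (fun j => k t j w) (fun j => l t j w) - mb w.
    by apply/funext => w; rewrite PPS_dev.
  by apply: vec_measurableB => //; exact: Omega_nextv.
have mSO := Omega_nextv _ mS.
have muO := Omega_nextv _ muN.
have mAO := Omega_next _ mAN.
apply: (@le_trans _ _ (\int[P]_w (A1 w * expR (dot (u w) (Q w)
    + 6 / 5 * kappa * dot (Q w) (Q w)))%:E)%E).
  apply: le_integral_ge0.
  - have meO : @vec_measurable R n _ Omega e.
      by rewrite (_ : e = fun w => Q w + S w); [exact: vec_measurableD|exact/funext].
    apply: measurable_funM => //; apply: measurable_expR_comp; apply: measurable_funD.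
      exact: measurable_dot.
    by apply: measurable_funM => //; exact: measurable_dot.
  - apply: measurable_funM; first exact: Omega_next mA1.
    apply: measurable_expR_comp; apply: measurable_funD; first exact: measurable_dot.
    by apply: measurable_funM => //; exact: measurable_dot.
  - by move=> w; rewrite mulr_ge0 ?expR_ge0.
  - move=> w; rewrite /A1 -mulrA -expRD ler_wpM2l // ler_expR eE.
    move: (Q w) (S w) (u w) => q p a.
    have := mulr_ge0 k0 (dot_ge0 (q - 5 *: p)).
    rewrite !dotE (dotC p q); lra.
have mbB w : norm1 (mb w) <= B.
  by apply: minibatch_norm1 => // c; exact: (oracle_bounded oracle).
have kQ0 : 0 <= 6 / 5 * kappa by rewrite mulr_ge0.
have kS0 : 0 <= 6 * kappa by rewrite mulr_ge0.
have stepQ := quantization_mgf (P := P) n0 Mt0 B0 nextM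
  (fun j => quant_measurable fresh tT (j := j)) mmb mbB
  (fun E a b => quant_law fresh tT a b (H := E))
  (fun w => erefl (Q w)) muN mA1 A10 kQ0 rangeQ.
have stepS := minibatch_mgf (P := P) sigma0 oracle nowM
  (fun i => batch_measurable fresh tT (i := i))
  (fun E C => batch_law fresh tT (H := E) (C := C))
  (fun w => erefl (S w)) rt0 my mu_ mA2 A20 kS0 rangeS.
apply: le_trans stepQ _.
rewrite [leLHS](_ : _ = \int[P]_w (A2 w * expR (dot (u w) (S w)
    + 6 * kappa * dot (S w) (S w)))%:E)%E; last first.
  by apply: eq_integral => w _; rewrite /A1 /A2 mulrAC.
apply: le_trans stepS _.
have muuO : measurable_fun (setT : set Omega) (fun w => dot (u w) (u w)).
  exact: measurable_dot.
apply: le_integral_ge0.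
- apply: measurable_funM; first exact: (measurable_fun_finer nowM mA2).
  apply: measurable_expR_comp; exact: (measurable_fun_finer nowM (mbudget _ _ _ muu)).
- apply: measurable_funM => //; apply: measurable_expR_comp.
  by apply: measurable_funD => //; exact: measurable_funM.
- by move=> w; rewrite mulr_ge0 ?expR_ge0.
- move=> w; rewrite /A2 -mulrA -expRD ler_wpM2l // ler_expR.
  by have [] := budget_sum (dot_ge0 (u w)) k0 sQ0 sS0 split_v kv.
Qed.

End OracleCall.

(** * Concentration of the noise *)

Section RateRecursion.
Context {R : realType}.
Implicit Types lam rho w W : R.

(** Bound on the exponent rate at the first iteration when [lam] is the rate
    after iterations of total weight [W]. The feedback of the noise into the
    distance to the dual centre makes the rate grow backwards in time; it stays
    below [5 / 3 * lam] as long as [lam * W <= 1]. *)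
Definition inflated_rate lam W : R := lam / (1 - 2 / 5 * lam * W).

Lemma inflated_rate_step lam rho w W : 0 <= lam -> 0 <= rho -> rho <= w -> 0 <= W ->
  lam * (W + w) <= 1 ->
  let lam' := lam * (1 + 2 / 5 * lam * rho) in
  [/\ lam' * W <= 1, inflated_rate lam' W <= inflated_rate lam (W + w) &
      lam <= inflated_rate lam (W + w)].
Proof.
move=> l0 r0 rw W0 range lam'.
have w0 := le_trans r0 rw.
have lw := mulr_ge0 l0 w0; have lW := mulr_ge0 l0 W0; have lr := mulr_ge0 l0 r0.
have lrw : lam * rho <= lam * w by rewrite ler_wpM2l.
have lam'W : lam' * W <= 1.
  have -> : lam' * W = lam * W * (1 + 2 / 5 * (lam * rho)) by rewrite /lam'; ring.
  have h : lam * W <= 1 - lam * w by lra.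
  apply: (@le_trans _ _ ((1 - lam * w) * (1 + 2 / 5 * (lam * w)))); last by nra.
  by apply: ler_pM => //; lra.
have D0 : 0 < 1 - 2 / 5 * lam * (W + w) by lra.
have D'0 : 0 < 1 - 2 / 5 * lam' * W by lra.
rewrite /inflated_rate; split=> //; last by rewrite ler_pdivlMr //; nra.
rewrite ler_pdivrMr // mulrAC ler_pdivlMr // -subr_ge0.
have -> : lam * (1 - 2 / 5 * lam' * W) - lam' * (1 - 2 / 5 * lam * (W + w))
  = lam * (2 / 5 * (lam * w - lam * rho) + 4 / 25 * ((lam * rho) * (lam * w))).
  by rewrite /lam'; field.
rewrite mulr_ge0 // addr_ge0 // mulr_ge0 ?subr_ge0 // mulr_ge0 //.
Qed.

End RateRecursion.

Section Concentration.
Context {R : realType} {n : nat}.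
Hypothesis n0 : (0 < n)%N.
Variables (f : 'rV[R]_n -> R) (L : R).
Hypothesis fconv : @convex_function R 'rV[R]_n setT f.
Hypothesis fdiff : forall x : 'rV[R]_n, differentiable f x.
Hypothesis fLip : forall x y : 'rV[R]_n,
  norm2 (gradient f x - gradient f y) <= L * norm2 (x - y).
Variables (xs : 'rV[R]_n) (Rad : R).
Hypothesis fmin : forall x : 'rV[R]_n, f xs <= f x.
Hypothesis xsRad : norm2 xs <= Rad.
Context {dX} {Xi : measurableType dX} (mu : probability Xi R).
Variables (g : 'rV[R]_n -> Xi -> 'rV[R]_n) (sigma B : R).
Hypothesis sigma0 : 0 < sigma.
Hypothesis oracle : stochastic_oracle mu g f sigma B.
Variables (T : nat) (alpha beta : nat -> R).
Hypothesis coef : coefficients T alpha beta L.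
Variables (r M : nat -> nat).
Hypothesis r0 : forall t, (t <= T)%N -> (0 < r t)%N.
Hypothesis M0 : forall t, (t <= T)%N -> (0 < M t)%N.
Context {d} {Omega : measurableType d} (P : probability Omega R).
Variables (xi : nat -> nat -> Omega -> Xi) (k l : nat -> nat -> Omega -> 'I_n).
Variables x y z yhat G : nat -> Omega -> 'rV[R]_n.
Hypothesis method : forall w : Omega, primal_method T alpha beta
  (fun t v => PPS g (r t) (M t) v
     (fun i => xi t i w) (fun j => k t j w) (fun j => l t j w))
  (fun t => x t w) (fun t => y t w) (fun t => z t w)
  (fun t => yhat t w) (fun t => G t w).
Hypothesis fresh : fresh_sampling P mu g T r M xi k l y.

Let now t := past r M xi k l t t.
Let v t := sigma2 n B sigma (r t) (M t).
Let D t w := xs - dual_center alpha beta (G^~ w) t.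
Let e t w := gradient_error f (y^~ w) (G^~ w) t.
Let N t w := noise f L alpha beta xs (y^~ w) (G^~ w) t.

Lemma smoothness_ge0 : 0 <= L.
Proof.
have := le_trans (norm2_ge0 _) (fLip (delta_mx 0 (Ordinal n0)) 0).
rewrite subr0 pmulr_lge0 // lt_neqAle norm2_ge0 andbT eq_sym -sqrf_eq0 sqr_norm2.
by rewrite dot_delta mxE !eqxx oner_eq0.
Qed.

Let L0 := smoothness_ge0.

Lemma sigma2_gt0 t : (t <= T)%N -> 0 < v t.
Proof.
move=> tT; have := sigma2_split n0 sigma B (r0 tT) (M0 tT).
apply: lt_le_trans; apply: ltr_wpDr.
  rewrite mulr_ge0 // divr_ge0 // mulr_ge0 ?sqr_ge0 // mulr_ge0 //.
  by rewrite subr_ge0 invf_le1 ?ltr0n // ler1n.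
by rewrite mulr_gt0 // divr_gt0 ?exprn_gt0 // ltr0n r0.
Qed.

Let w_ t := Asum alpha t * v t / (beta t - L).

Let w_ge0 t : (t <= T)%N -> 0 <= w_ t.
Proof.
move=> tT; rewrite divr_ge0 ?subr_ge0 ?(ltW (beta_gtL coef tT)) //.
by rewrite mulr_ge0 ?ltW ?sigma2_gt0 // (Asum_gt0 coef).
Qed.

Let NS t w : N t.+1 w = N t w + (alpha t * dot (e t w) (D t w)
  + Asum alpha t * dot (e t w) (e t w) / (2 * (beta t - L))).
Proof. by rewrite /N /noise big_ord_recr. Qed.

Let sqr_xs_le : dot xs xs <= Rad ^+ 2.
Proof.
rewrite -sqr_norm2; apply: lerXn2r; rewrite ?nnegrE ?norm2_ge0 //.
exact: le_trans (norm2_ge0 _) xsRad.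
Qed.

Let D_bound t w : (t < T)%N ->
  beta t * dot (D t.+1 w) (D t.+1 w) <= beta t * Rad ^+ 2 + 2 * N t.+1 w.
Proof.
move=> tT.
have := primal_potential fdiff fconv fLip coef L0 (method w) xs (ltnW tT).
rewrite -/(D t.+1 w) -/(N t.+1 w) => pot.
have A0 := Asum_gt0 coef (ltnW tT).
have gap : 0 <= Asum alpha t * (f (x t w) - f xs).
  by rewrite mulr_ge0 ?(ltW A0) // subr_ge0.
have b0 := beta_gt0 coef L0 (ltnW tT).
have : beta t * dot xs xs <= beta t * Rad ^+ 2.
  by rewrite ler_wpM2l ?(ltW b0).
lra.
Qed.

(** The squared distance to the dual centre is paid for by the initial radius
    and by the noise collected so far. *)
Let distance_feedback t : (t <= T)%N -> exists rho, [/\ 0 <= rho, rho <= w_ t &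
  forall w, alpha t ^+ 2 * v t * dot (D t w) (D t w)
    <= alpha t ^+ 2 * v t * Rad ^+ 2 + 2 * rho * N t w].
Proof.
case: t => [|t] tT.
  exists 0; split=> //; first exact: w_ge0.
  move=> w; rewrite mulr0 mul0r addr0 /D dual_center0 subr0.
  by apply: ler_wpM2l => //; rewrite mulr_ge0 ?sqr_ge0 // ltW // sigma2_gt0.
have b0 := beta_gt0 coef L0 (ltnW tT).
have b1 := beta_gt0 coef L0 tT.
have v0 := sigma2_gt0 tT.
have A0 := Asum_gt0 coef tT.
have bL := beta_gtL coef tT.
have ab := alpha_beta coef tT.
exists (alpha t.+1 ^+ 2 * v t.+1 / beta t); split.
- by rewrite divr_ge0 ?(ltW b0) // mulr_ge0 ?sqr_ge0 ?(ltW v0).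
(* this is where alpha_t^2 beta_t <= beta_(t-1) A_t enters *)
- rewrite /w_ mulrAC [leRHS]mulrAC ler_pM2r //.
  rewrite ler_pdivrMr // mulrAC ler_pdivlMr ?subr_gt0 //.
  apply: (@le_trans _ _ (alpha t.+1 ^+ 2 * beta t.+1)).
    by rewrite ler_wpM2l ?sqr_ge0 // gerBl.
  by rewrite [leRHS]mulrC.
- move=> w; have := D_bound w tT.
  have c0 : 0 <= alpha t.+1 ^+ 2 * v t.+1 / beta t.
    by rewrite divr_ge0 ?(ltW b0) // mulr_ge0 ?sqr_ge0 ?(ltW v0).
  move=> /(ler_wpM2l c0).
  have -> : alpha t.+1 ^+ 2 * v t.+1 / beta t * (beta t * dot (D t.+1 w) (D t.+1 w))
     = alpha t.+1 ^+ 2 * v t.+1 * dot (D t.+1 w) (D t.+1 w).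
    by field; apply: lt0r_neq0.
  move=> /le_trans; apply; rewrite le_eqVlt; apply/orP; left; apply/eqP.
  by field; apply: lt0r_neq0.
Qed.

Let measurable_now t : (t <= T)%N ->
  [/\ @vec_measurable R n _ (now t) (y t), @vec_measurable R n _ (now t) (D t) &
      measurable_fun setT (N t : now t -> R)].
Proof.
move=> tT; have [before yt] := iterates_measurable oracle method (leqW tT).
have mD s : (s <= t)%N -> @vec_measurable R n _ (now t) (D s).
  move=> st; apply: vec_measurableB; first exact: vec_measurable_cst.
  apply: vec_measurableZl; apply: vec_measurable_sum => i; apply: vec_measurableZl.
  by have [] := before i (leq_trans (ltn_ord i) st).
split; [exact: yt|exact: mD|].
apply: measurable_sum => i.
have [mG _ my] := before i (ltn_ord i).
have me : @vec_measurable R n _ (now t) (e i).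
  by apply: vec_measurableB => //; exact: (vec_measurable_gradient oracle).
apply: measurable_funD; apply: measurable_funM => //.
  by apply: measurable_dot => //; apply: mD; exact: ltnW.
by apply: measurable_funM => //; exact: measurable_dot.
Qed.

Let now_measurable t : (t <= T)%N ->
  sampling_events r M xi k l t t `<=` @measurable _ Omega.
Proof. by move=> tT; apply: (sampling_events_measurable fresh); exact: leqW. Qed.

Lemma noise_measurable t : (t <= T.+1)%N -> measurable_fun (setT : set Omega) (N t).
Proof.
case: t => [|t] tT.
  rewrite (_ : N 0 = fun=> 0) //.
  by apply/funext => w; rewrite /N /noise big_ord0.
have [before _] := iterates_measurable oracle method tT.
have evM : sampling_events r M xi k l t.+1 t.+1 `<=` @measurable _ Omega.
  exact: (sampling_events_measurable fresh).
have [_ mD mN] := measurable_now tT.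
have [mG _ my] := before t (ltnSn t).
have mDO : @vec_measurable R n _ Omega (D t).
  by move=> i; exact: measurable_fun_finer (now_measurable tT) (mD i).
have meO : @vec_measurable R n _ Omega (e t).
  apply: vec_measurableB.
    by move=> i; exact: measurable_fun_finer evM (mG i).
  apply: (vec_measurable_gradient oracle) => i.
  exact: measurable_fun_finer evM (my i).
rewrite (_ : N t.+1 = fun w => N t w + (alpha t * dot (e t w) (D t w)
  + Asum alpha t * dot (e t w) (e t w) / (2 * (beta t - L)))); last exact/funext/NS.
apply: measurable_funD; first exact: measurable_fun_finer (now_measurable tT) mN.
apply: measurable_funD; apply: measurable_funM => //; first exact: measurable_dot.
by apply: measurable_funM => //; exact: measurable_dot.
Qed.

(* conditionally on the past, the increment is linear plus quadratic in the
   oracle error, which is the situation of [oracle_call_mgf] *)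
Let noise_step t lam : (t <= T)%N -> 0 <= lam -> lam * w_ t <= 5 / 3 ->
  (\int[P]_w (expR (lam * N t.+1 w))%:E <= \int[P]_w
     (expR (lam * N t w) * expR (v t / 5 * (lam ^+ 2 * alpha t ^+ 2 * dot (D t w) (D t w))
          + lam * w_ t / 4))%:E)%E.
Proof.
move=> tT lam0 range.
have [my mD mN] := measurable_now tT.
have bL : 0 < beta t - L by rewrite subr_gt0 (beta_gtL coef).
have A0 := Asum_gt0 coef tT.
pose kappa := lam * (Asum alpha t / (2 * (beta t - L))).
have k0 : 0 <= kappa.
  by rewrite mulr_ge0 // divr_ge0 ?(ltW A0) // mulr_ge0 // ltW.
have kv : kappa * v t = lam * w_ t / 2.
  by rewrite /kappa /w_; field; apply: lt0r_neq0.
have kv' : kappa * v t <= 5 / 6 by rewrite kv; lra.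
have eE w : e t w = PPS g (r t) (M t) (y t w) (fun i => xi t i w)
      (fun j => k t j w) (fun j => l t j w) - gradient f (y t w).
  by rewrite /e /gradient_error (primal_G (method w) tT).
have muN : @vec_measurable R n _ (now t) (fun w => (lam * alpha t) *: D t w).
  exact: vec_measurableZl.
have mA : measurable_fun setT (fun w : now t => expR (lam * N t w)).
  by apply: measurable_expR_comp; exact: measurable_funM.
have := oracle_call_mgf n0 fresh sigma0 oracle tT (r0 tT) (M0 tT) my eE muN mA
  (fun w => expR_ge0 _) k0 kv'.
rewrite -/(v t).
under eq_integral => w _.
  have -> : expR (lam * N t w) * expR (dot ((lam * alpha t) *: D t w) (e t w)
     + kappa * dot (e t w) (e t w)) = expR (lam * N t.+1 w).
    rewrite -expRD NS dotZl (dotC (D t w)) /kappa; congr expR.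
    by field; apply: lt0r_neq0.
  over.
move=> /le_trans; apply; rewrite le_eqVlt; apply/orP; left; apply/eqP.
apply: eq_integral => w _; rewrite kv dotZl dotZr; congr (_ * expR _)%:E.
by field.
Qed.

Let V t := \sum_(i < t) alpha i ^+ 2 * v i.
Let W t := \sum_(i < t) w_ i.

(** Backward recursion: averaging out one iteration turns the rate [lam] into
    [lam * (1 + 2 / 5 * lam * rho)] one iteration earlier. *)
Lemma noise_mgf t lam : (t <= T.+1)%N -> 0 <= lam -> lam * W t <= 1 ->
  (\int[P]_w (expR (lam * N t w))%:E <=
    (expR (inflated_rate lam (W t) ^+ 2 / 5 * Rad ^+ 2 * V t
           + inflated_rate lam (W t) / 4 * W t))%:E)%E.
Proof.
elim: t lam => [|t IH] lam tT lam0 range.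
  rewrite /V /W !big_ord0 !mulr0 addr0.
  under eq_integral do rewrite /N /noise big_ord0 mulr0.
  by rewrite integral_cst //= probability_setT mule1.
have w0 := w_ge0 tT.
have W0 : 0 <= W t.
  by apply: sumr_ge0 => i _; apply: w_ge0; exact: leq_trans (ltnW (ltn_ord i)) tT.
have V0 : 0 <= V t.
  apply: sumr_ge0 => i _; rewrite mulr_ge0 ?sqr_ge0 // ltW // sigma2_gt0 //.
  exact: leq_trans (ltnW (ltn_ord i)) tT.
have WS : W t.+1 = W t + w_ t by rewrite /W big_ord_recr.
have VS : V t.+1 = V t + alpha t ^+ 2 * v t by rewrite /V big_ord_recr.
rewrite WS in range *; rewrite VS.
have [rho [rho0 rhow fb]] := distance_feedback tT.
have := inflated_rate_step lam0 rho0 rhow W0 range.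
set lam' := lam * (1 + 2 / 5 * lam * rho) => -[range' mono le_infl].
have lam'0 : 0 <= lam' by rewrite mulr_ge0 // addr_ge0 // !mulr_ge0.
have lw : lam * w_ t <= 5 / 3 by have := mulr_ge0 lam0 W0; lra.
apply: le_trans (noise_step tT lam0 lw) _.
have [_ mD mN] := measurable_now tT.
have mNO : measurable_fun (setT : set Omega) (N t) by exact: noise_measurable (ltnW tT).
have mDO : @vec_measurable R n _ Omega (D t).
  by move=> i; exact: measurable_fun_finer (now_measurable tT) (mD i).
pose c := lam ^+ 2 / 5 * Rad ^+ 2 * (alpha t ^+ 2 * v t) + lam / 4 * w_ t.
apply: (@le_trans _ _ (\int[P]_w (expR c * expR (lam' * N t w))%:E)%E).
  apply: le_integral_ge0.
  - apply: measurable_funM; apply: measurable_expR_comp; first exact: measurable_funM.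
    apply: measurable_funD => //; apply: measurable_funM => //; apply: measurable_funM => //.
    exact: measurable_dot.
  - by apply: measurable_funM => //; apply: measurable_expR_comp; exact: measurable_funM.
  - by move=> w; rewrite mulr_ge0 ?expR_ge0.
  - move=> w; rewrite -!expRD ler_expR.
    have := ler_wpM2l (sqr_ge0 lam) (fb w); rewrite /c /lam'; lra.
rewrite integral_scale ?expR_ge0 //; last first.
  by apply: measurable_expR_comp; exact: measurable_funM.
apply: le_trans (lee_wpmul2l _ (IH lam' (ltnW tT) lam'0 range')) _.
  by rewrite lee_fin expR_ge0.
rewrite -EFinM lee_fin -expRD ler_expR.
have infl'0 : 0 <= inflated_rate lam' (W t).
  by rewrite divr_ge0 // subr_ge0; lra.
move: mono le_infl; set I := inflated_rate lam (W t + w_ t); set I' := inflated_rate lam' (W t).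
move=> mono le_infl.
have I0 : 0 <= I by exact: le_trans lam0 le_infl.
have sq1 : lam ^+ 2 <= I ^+ 2 by apply: lerXn2r; rewrite ?nnegrE.
have sq2 : I' ^+ 2 <= I ^+ 2 by apply: lerXn2r; rewrite ?nnegrE.
have a0 : 0 <= alpha t ^+ 2 * v t by rewrite mulr_ge0 ?sqr_ge0 // ltW // sigma2_gt0.
have h1 := ler_wpM2r (mulr_ge0 (sqr_ge0 Rad) a0) sq1.
have h2 := ler_wpM2r (mulr_ge0 (sqr_ge0 Rad) V0) sq2.
have h3 := ler_wpM2r w0 le_infl.
have h4 := ler_wpM2r W0 mono.
rewrite /c; lra.
Qed.

(** Chernoff's bound. The first term of the threshold is the Gaussian regime,
    the second one the exponential regime forced by the quadratic part of the
    noise. *)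
Lemma noise_tail (delta : R) : 0 < delta -> delta < 1 -> 0 <= Rad ->
  (P [set w | (Num.sqrt (3 * ln (4 / delta)) * Rad * Num.sqrt (V T.+1)
       + (1 + ln (4 / delta)) * W T.+1 <= N T.+1 w)%R] <= (delta / 4)%:E)%E.
Proof.
move=> d0 d1 Rad0.
set ell := ln (4 / delta); set gam := Num.sqrt (3 * ell).
have ell0 : 0 < ell by apply: ln_gt0; rewrite ltr_pdivlMr //; lra.
have gam0 : 0 < gam by rewrite sqrtr_gt0 mulr_gt0.
have gam2 : gam ^+ 2 = 3 * ell by rewrite sqr_sqrtr // ltW // mulr_gt0.
have W0 : 0 < W T.+1.
  rewrite /W big_ord_recl ltr_pwDl //.
    rewrite divr_gt0 ?subr_gt0 ?(beta_gtL coef) // mulr_gt0 ?sigma2_gt0 //.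
    exact: (Asum_gt0 coef).
  by apply: sumr_ge0 => i _; apply: w_ge0; rewrite /= /bump add1n.
have V0 : 0 <= V T.+1.
  by apply: sumr_ge0 => i _; rewrite mulr_ge0 ?sqr_ge0 // ltW // sigma2_gt0 // -ltnS.
set Y := Rad * Num.sqrt (V T.+1).
have Y0 : 0 <= Y by rewrite mulr_ge0 ?sqrtr_ge0.
have Y2 : Y ^+ 2 = Rad ^+ 2 * V T.+1 by rewrite exprMn sqr_sqrtr.
have den0 : 0 < W T.+1 + Y / gam by rewrite ltr_pwDl // divr_ge0 // ltW.
(* the rate balances the two regimes of the tail bound *)
pose lam := (W T.+1 + Y / gam)^-1.
have lam0 : 0 < lam by rewrite invr_gt0.
have lden : lam * W T.+1 + lam * (Y / gam) = 1.
  by rewrite -mulrDr mulVf // lt0r_neq0.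
have lW0 : 0 <= lam * W T.+1 by rewrite mulr_ge0 // ltW.
have lY0 : 0 <= lam * (Y / gam) by rewrite mulr_ge0 ?divr_ge0 // ltW.
have range : lam * W T.+1 <= 1 by lra.
have mgf := noise_mgf (leqnn T.+1) (ltW lam0) range.
pose X : {RV P >-> R} := HB.pack (N T.+1)
  (isMeasurableFun.Build _ _ _ _ _ (noise_measurable (leqnn T.+1))).
rewrite -[gam * Rad * _]mulrA -/Y.
set c := gam * Y + (1 + ell) * W T.+1.
apply: le_trans (chernoff X c lam0) _.
rewrite /mmt_gen_fun unlock.
under eq_integral do rewrite /= mulrC.
have e0 : (0 <= (expR (- (lam * c)))%:E)%E by rewrite lee_fin expR_ge0.
apply: le_trans (lee_wpmul2r e0 mgf) _.
rewrite -EFinM lee_fin -expRD.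
have -> : delta / 4 = expR (- ell).
  by rewrite expRN /ell lnK ?posrE ?divr_gt0 // invf_div.
rewrite ler_expR.
set I := inflated_rate lam (W T.+1).
have I0 : 0 <= I by rewrite divr_ge0 ?(ltW lam0) //; lra.
have IE : I <= 5 / 3 * lam.
  by rewrite /I /inflated_rate ler_pdivrMr; nra.
have I2 : I ^+ 2 <= 25 / 9 * lam ^+ 2.
  have -> : 25 / 9 * lam ^+ 2 = (5 / 3 * lam) ^+ 2 by field.
  by apply: lerXn2r => //; rewrite nnegrE // mulr_ge0 // ltW.
have hq : I ^+ 2 / 5 * Rad ^+ 2 * V T.+1 <= 5 / 9 * (lam * Y) ^+ 2.
  rewrite -mulrA -Y2.
  have := ler_wpM2r (sqr_ge0 Y) I2; rewrite [(lam * Y) ^+ 2]exprMn; lra.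
have hw : I / 4 * W T.+1 <= 5 / 12 * (lam * W T.+1).
  by have := ler_wpM2r (ltW W0) IE; lra.
(* after rescaling, the two terms of the rate's denominator add up to 1 *)
have lYE : lam * Y = lam * (Y / gam) * gam by field; apply: lt0r_neq0.
have -> : lam * c = lam * Y * gam + (1 + ell) * (lam * W T.+1) by rewrite /c; ring.
move: hq hw; rewrite lYE; move: (lam * (Y / gam)) (lam * W T.+1) lden lW0 lY0 => a b ab b0 a0.
have -> : (a * gam) ^+ 2 = a ^+ 2 * (3 * ell) by rewrite exprMn gam2.
have -> : a * gam * gam = a * (3 * ell) by rewrite -mulrA -expr2 gam2.
have aa : a ^+ 2 * ell <= a * ell.
  by rewrite ler_wpM2r ?(ltW ell0) // expr2 ler_piMl //; lra.
have bE : b = 1 - a by lra.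
rewrite {}bE in b0 *; have := mulr_ge0 a0 (ltW ell0); lra.
Qed.

(** By [primal_potential] the objective can exceed [epsilon] only if the noise
    exceeds the threshold of [noise_tail]; [0 <= J * Rad] makes the coefficient
    [C1 J delta] at least [sqrt (3 ln (4 / delta))] on the scale of [Rad]. *)
Lemma primal_high_probability (J delta : R) : 0 <= J * Rad -> 0 < delta -> delta < 1 ->
  ((1 - delta)%:E < P [set w | (f (x T w) - f xs
       <= epsilon n T J Rad L B sigma delta alpha beta r M)%R])%E.
Proof.
move=> JR d0 d1.
have Rad0 : 0 <= Rad := le_trans (norm2_ge0 _) xsRad.
set eps := epsilon _ _ _ _ _ _ _ _ _ _ _ _.
set E := [set w | _].
have A0 := Asum_gt0 coef (leqnn T).
have b0 := beta_gt0 coef L0 (leqnn T).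
have mfx : measurable_fun (setT : set Omega) (fun w => f (x T w)).
  apply: (measurable_objective oracle fdiff fconv fLip) => i.
  have [/(_ T (ltnSn T)) [_ mx _] _] := iterates_measurable oracle method (leqnn T.+1).
  by apply: measurable_fun_finer (mx i); exact: (sampling_events_measurable fresh).
have mE : measurable E.
  have -> : E = (fun w => f (x T w) - f xs) @^-1` `]-oo, eps].
    by apply/seteqP; split=> w /=; rewrite in_itv.
  rewrite -[X in measurable X]setTI; apply: measurable_funB => //.
have mN := noise_measurable (leqnn T.+1).
pose F := [set w | Num.sqrt (3 * ln (4 / delta)) * Rad * Num.sqrt (V T.+1)
       + (1 + ln (4 / delta)) * W T.+1 <= N T.+1 w].
have mF : measurable F.
  set c := _ + _ in F *; have -> : F = N T.+1 @^-1` `[c, +oo[.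
    by apply/seteqP; split=> w /=; rewrite in_itv /= andbT.
  by rewrite -[X in measurable X]setTI; apply: mN.
have EF : ~` E `<=` F.
  move=> w /= /negP; rewrite -ltNge => lt.
  have := primal_potential fdiff fconv fLip coef L0 (method w) xs (leqnn T).
  rewrite -/(N T.+1 w) => pot.
  have {}pot : Asum alpha T * (f (x T w) - f xs) <= beta T / 2 * Rad ^+ 2 + N T.+1 w.
    have dd := dot_ge0 (xs - dual_center alpha beta (G^~ w) T.+1).
    have := mulr_ge0 (ltW b0) dd; have := ler_wpM2l (ltW b0) sqr_xs_le.
    move: pot; lra.
  have : Asum alpha T * eps < Asum alpha T * (f (x T w) - f xs) by rewrite ltr_pM2l.
  have -> : Asum alpha T * eps = beta T / 2 * Rad ^+ 2
     + C1 J delta * Rad * Num.sqrt (V T.+1) + C2 delta * W T.+1.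
    by rewrite /eps /epsilon -/(W T.+1) -/(V T.+1); field; apply: lt0r_neq0.
  set gam := Num.sqrt (3 * ln (4 / delta)).
  have c1 : gam * Rad <= C1 J delta * Rad.
    rewrite /C1 -/gam.
    have s0 : 0 <= Num.sqrt 2 :> R := sqrtr_ge0 _.
    have s2 : Num.sqrt 2 ^+ 2 = 2 :> R by rewrite sqr_sqrtr.
    have g0 : 0 <= gam := sqrtr_ge0 _.
    set s := Num.sqrt 2 in s0 s2 *.
    have -> : ((2 * J + s - 1) * (s + (s + 1) * gam) + s - 2) * Rad
      = 2 * (J * Rad) * (s + (s + 1) * gam)
        + (s ^+ 2 - 2) * (1 + gam) * Rad + gam * Rad by ring.
    have t0 : 0 <= s + (s + 1) * gam by rewrite addr_ge0 // mulr_ge0 // addr_ge0.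
    rewrite s2 subrr !mul0r addr0 lerDr.
    by apply: mulr_ge0 => //; exact: mulr_ge0.
  have := ler_wpM2r (sqrtr_ge0 (V T.+1)) c1.
  rewrite /F /C2 /= -/gam; lra.
have PF := noise_tail d0 d1 Rad0.
have PE : (P (~` E) <= (delta / 4)%:E)%E.
  apply: le_trans PF; apply: le_measure; rewrite ?inE //.
  exact: measurableC.
move: PE; rewrite probability_setC //.
have -> : P E = (fine (P E))%:E by rewrite fineK // fin_num_measure.
rewrite -EFinB lee_fin lte_fin; lra.
Qed.

End Concentration.

(** * Growth of the constants *)

Section RateAsymptotics.
Context {R : realType}.

Lemma near0_ln_ge1 : \forall e \near (0 : R)^'+, 0 < e /\ 1 <= ln (1 / e).
Proof.
near=> e.
have e0 : 0 < e by near: e; exact: nbhs_right_gt.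
split=> //; rewrite -[X in X <= _](expRK 1) ler_ln ?posrE ?expR_gt0 ?divr_gt0 //.
rewrite ler_pdivlMr // mulrC -ler_pdivlMr ?expR_gt0 // mul1r.
by near: e; apply: nbhs_right_le; rewrite invr_gt0 expR_gt0.
Unshelve. all: by end_near. Qed.

Let ln4_ge0 : 0 <= ln 4 :> R.
Proof. by rewrite ln_ge0 // ler1n. Qed.

Let ln4div (e : R) : 0 < e -> ln (4 / e) = ln 4 + ln (1 / e).
Proof. by move=> e0; rewrite -lnM ?posrE ?divr_gt0 // mul1r. Qed.

Lemma C2_bigO : C2 =O_ (0^'+) (fun e : R => ln (1 / e)).
Proof.
apply/eqO_exP; exists (2 + ln 4); first by rewrite ltr_pwDl.
near=> e.
have [e0 l1] : 0 < e /\ 1 <= ln (1 / e) by near: e; exact: near0_ln_ge1.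
have a0 := ln4_ge0.
rewrite /C2 ln4div // !ger0_norm; [|lra|lra].
by move: (ln 4) (ln (1 / e)) a0 l1 => a b; nra.
Unshelve. all: by end_near. Qed.

Lemma poly_upto_ge1 i (h : R) : 0 <= h -> 1 <= poly_upto i h.
Proof.
move=> h0; rewrite /poly_upto big_ord_recl expr0 lerDl; apply: sumr_ge0 => j _.
exact: exprn_ge0.
Qed.

(** The [poly_upto] factor bounds [J], and it is at least one, as is
    [sqrt (ln (1 / delta))], so the constant terms of [C1] are absorbed. *)
Lemma C1_bigO (J : nat -> R) i :
  J =O_ \oo (fun S : nat => poly_upto i (ln (S%:R : R))) ->
  (fun p : nat * R => C1 (J p.1) p.2) =O_ (filter_prod \oo 0^'+)
    (fun p : nat * R => poly_upto i (ln (p.1%:R : R)) * Num.sqrt (ln (1 / p.2))).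
Proof.
move=> /eqO_exP[K K0 JK].
pose q := Num.sqrt (3 * (ln 4 + 1)) : R.
pose s2 := Num.sqrt 2 : R.
have q0 : 0 <= q := sqrtr_ge0 _.
have s0 : 0 <= s2 := sqrtr_ge0 _.
apply/eqO_exP.
exists ((2 * K + s2 + 1) * (s2 + (s2 + 1) * q) + s2 + 2).
  rewrite ltr_pwDr // addr_ge0 // mulr_ge0 ?addr_ge0 ?mulr_ge0 //.
    exact: ltW.
  by rewrite addr_ge0.
exists ([set S : nat | (0 < S)%N /\ `|J S| <= K * `|poly_upto i (ln (S%:R : R))|],
        [set e : R | 0 < e /\ 1 <= ln (1 / e)]) => /=.
  split; last exact: near0_ln_ge1.
  near=> S; split; last by near: S; exact: JK.
  by near: S; exists 1%N.
move=> [S e] /= [[S0 JS] [e0 l1]].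
have h1 : 1 <= poly_upto i (ln (S%:R : R)).
  by apply: poly_upto_ge1; rewrite ln_ge0 // ler1n.
set p := poly_upto i _ in h1 JS *.
have p0 : 0 <= p by lra.
rewrite (ger0_norm p0) in JS.
set s := Num.sqrt (ln (1 / e)).
have s1 : 1 <= s by rewrite -[1]sqrtr1 ler_wsqrtr.
have gs : Num.sqrt (3 * ln (4 / e)) <= q * s.
  rewrite -sqrtrM; last by rewrite mulr_ge0 // addr_ge0.
  apply: ler_wsqrtr; rewrite ln4div //.
  by have := ln4_ge0; move: (ln 4) (ln (1 / e)) l1 => a b b1 a0; nra.
have g0 : 0 <= Num.sqrt (3 * ln (4 / e)) :> R := sqrtr_ge0 _.
rewrite [X in _ <= _ * X]ger0_norm; last by rewrite mulr_ge0 //; lra.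
rewrite /C1 -/s2; set gam := Num.sqrt (3 * ln (4 / e)) in gs g0 *.
apply: (@le_trans _ _ (`|2 * J S + s2 - 1| * (s2 + (s2 + 1) * gam) + s2 + 2)).
  have y0 : 0 <= s2 + (s2 + 1) * gam by rewrite addr_ge0 // mulr_ge0 // addr_ge0.
  rewrite -[X in `|_| * X](ger0_norm y0) -normrM -addrA -[leRHS]addrA.
  apply: le_trans (ler_normD _ _) _; rewrite lerD2l.
  by rewrite ler_norml; apply/andP; split; lra.
have J1 : `|2 * J S + s2 - 1| <= (2 * K + s2 + 1) * p.
  move: JS; rewrite !ler_norml => /andP[j1 j2].
  have sp : s2 <= s2 * p by rewrite ler_peMr.
  by apply/andP; split; lra.
have y1 : s2 + (s2 + 1) * gam <= (s2 + (s2 + 1) * q) * s.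
  have := ler_wpM2l (addr_ge0 s0 ler01) gs.
  have : s2 <= s2 * s by rewrite ler_peMr.
  lra.
have y0 : 0 <= s2 + (s2 + 1) * gam by rewrite addr_ge0 // mulr_ge0 // addr_ge0.
have ps : 1 <= p * s by rewrite -[1]mulr1; apply: ler_pM.
have := ler_pM (normr_ge0 _) y0 J1 y1 => h.
have h2 : s2 + 2 <= (s2 + 2) * (p * s) by rewrite ler_peMr // addr_ge0.
by rewrite [leRHS](_ : _ = (2 * K + s2 + 1) * p * ((s2 + (s2 + 1) * q) * s)
   + (s2 + 2) * (p * s)); [lra|ring].
Unshelve. all: by end_near. Qed.

End RateAsymptotics.

(** * High-probability convergence *)

Theorem theorem1 (R : realType) (n : nat) (hn : (0 < n)%N)
    (f : 'rV[R]_n -> R) (L : R)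
    (hconv : @convex_function R 'rV[R]_n setT f)
    (hdiff : forall x : 'rV[R]_n, differentiable f x)
    (hLip : forall x y : 'rV[R]_n,
      norm2 (gradient f x - gradient f y) <= L * norm2 (x - y))
    (xs : 'rV[R]_n) (hmin : forall x : 'rV[R]_n, f xs <= f x)
    (Rad : R) (hRad : norm2 xs <= Rad)
    (dX : measure_display) (Xi : measurableType dX) (mu : probability Xi R)
    (g : 'rV[R]_n -> Xi -> 'rV[R]_n) (sigma B : R) (hsigma : 0 < sigma)
    (horacle : stochastic_oracle mu g f sigma B)
    (T : nat) (alpha beta : nat -> R) (hcoef : coefficients T alpha beta L)
    (r M : nat -> nat)
    (hr : forall t, (t <= T)%N -> (0 < r t)%N)
    (hM : forall t, (t <= T)%N -> (0 < M t)%N)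
    (d : measure_display) (Omega : measurableType d) (P : probability Omega R)
    (xi : nat -> nat -> Omega -> Xi) (k l : nat -> nat -> Omega -> 'I_n)
    (x y z yhat G : nat -> Omega -> 'rV[R]_n)
    (hmethod : forall w : Omega,
      primal_method T alpha beta
        (fun t v => PPS g (r t) (M t) v
           (fun i => xi t i w) (fun j => k t j w) (fun j => l t j w))
        (fun t => x t w) (fun t => y t w) (fun t => z t w)
        (fun t => yhat t w) (fun t => G t w))
    (hsampling : fresh_sampling P mu g T r M xi k l y)
    (J : nat -> R)
    (hJ : {ae P, forall w, forall t, (t <= T)%N -> norm2 (y t w - xs) <= J T * Rad})
    (hJO : exists i : nat, J =O_ \oo (fun S : nat => poly_upto i (ln (S%:R : R))))
    (delta : R) (hdelta : 0 < delta < 1) :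
  [/\ ((1 - delta)%:E <
        P [set w | (f (x T w) - f xs
                   <= epsilon n T (J T) Rad L B sigma delta alpha beta r M)%R])%E,
      C2 =O_ (0^'+) (fun e : R => ln (1 / e)) &
      exists i : nat,
        (fun p : nat * R => C1 (J p.1) p.2) =O_ (filter_prod \oo 0^'+)
        (fun p : nat * R =>
           poly_upto i (ln (p.1%:R : R)) * Num.sqrt (ln (1 / p.2)))].
Proof.
move: hdelta => /andP[d0 d1]; split.
- apply: (primal_high_probability hn hconv hdiff hLip hmin hRad hsigma horacle
    hcoef hr hM hmethod hsampling) => //.
  (* an event of probability one is not empty, and a distance is nonnegative *)
  have : P.-negligible (~` [set w | forall t, (t <= T)%N -> norm2 (y t w - xs) <= J T * Rad]) by [].
  case=> N [mN PN sub].
  have [w Nw] : exists w, ~ N w.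
    apply/existsNP => allN.
    have : P N = 1%E by rewrite (_ : N = setT) ?probability_setT //; apply/seteqP; split.
    by rewrite PN => /eqP; rewrite eqe eq_sym oner_eq0.
  have : forall t, (t <= T)%N -> norm2 (y t w - xs) <= J T * Rad.
    by apply: contrapT => h; exact: Nw (sub _ h).
  by move=> /(_ 0%N (leq0n T)); apply: le_trans; exact: norm2_ge0.
- exact: C2_bigO.
- by have [i Ji] := hJO; exists i; exact: C1_bigO.
Qed.
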